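(* Let $K$ be a Corson compact space whose weight $w(K)$ satisfies $w(K)\ge\mathfrak c$. Then there exists a nontrivial twisted sum of $c_0$ and $C(K)$. In particular, assuming the Continuum Hypothesis ($\mathfrak c=\omega_1$), for every nonmetrizable Corson compact space $K$ there exists a nontrivial twisted sum of $c_0$ and $C(K)$.
   Context: For a compact Hausdorff space $K$, $C(K)$ is the Banach space of continuous real-valued functions on $K$ with the supremum norm; $c_0$ is the Banach space of real sequences converging to zero with the sup norm. For Banach spaces $Y,X$, a twisted sum of $Y$ and $X$ is a short exact sequence $0\to Y\to Z\to X\to 0$ where $Z$ is a Banach space and the maps are bounded linear operators; it is trivial if it splits, i.e., the image of $Y\to Z$ is complemented in $Z$. $\mathfrak c$ denotes the cardinality of the continuum. For an index set $I$, $\Sigma(I)=\{x\in\mathbb R^I:\{i\in I: x_i\neq 0\}\text{ is countable}\}$. A compact Hausdorff space $K$ is a Corson compactum if there exist an index set $I$ and a continuous injection $\varphi:K\to\mathbb R^I$ with $\varphi[K]\subset\Sigma(I)$. *)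

(* Defs.v *)
From Stdlib Require Import Reals List.
Open Scope R_scope.

Record Topology (X : Type) := mkTopology {
  is_open : (X -> Prop) -> Prop;
  open_full : is_open (fun _ => True);
  open_inter : forall U V, is_open U -> is_open V -> is_open (fun x => U x /\ V x);
  open_union : forall F : (X -> Prop) -> Prop,
      (forall U, F U -> is_open U) -> is_open (fun x => exists U, F U /\ U x)
}.
Arguments is_open {X} t U.

Definition compact {X : Type} (T : Topology X) : Prop :=
  forall F : (X -> Prop) -> Prop,
    (forall U, F U -> is_open T U) ->
    (forall x, exists U, F U /\ U x) ->
    exists l : list (X -> Prop),
      (forall U, In U l -> F U) /\ (forall x, exists U, In U l /\ U x).

Definition hausdorff {X : Type} (T : Topology X) : Prop :=
  forall x y : X, x <> y ->
    exists U V, is_open T U /\ is_open T V /\ U x /\ V y /\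
                (forall z, ~ (U z /\ V z)).

Definition compact_hausdorff {X : Type} (T : Topology X) : Prop :=
  compact T /\ hausdorff T.

Definition continuous_real {X : Type} (T : Topology X) (f : X -> R) : Prop :=
  forall x eps, 0 < eps ->
    exists U, is_open T U /\ U x /\ (forall y, U y -> Rabs (f y - f x) < eps).

Definition product_open {I : Type} (U : (I -> R) -> Prop) : Prop :=
  forall x, U x ->
    exists (l : list I) (eps : R), 0 < eps /\
      forall y, (forall i, In i l -> Rabs (y i - x i) < eps) -> U y.

Definition continuous_into_product {X I : Type} (T : Topology X)
  (phi : X -> (I -> R)) : Prop :=
  forall U : (I -> R) -> Prop, product_open U -> is_open T (fun x => U (phi x)).

Definition countable_set {A : Type} (S : A -> Prop) : Prop :=
  exists g : A -> nat, forall a b, S a -> S b -> g a = g b -> a = b.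

Definition in_Sigma {I : Type} (x : I -> R) : Prop :=
  countable_set (fun i => x i <> 0).

Definition corson {X : Type} (T : Topology X) : Prop :=
  compact_hausdorff T /\
  exists (I : Type) (phi : X -> (I -> R)),
    continuous_into_product T phi /\
    (forall x y, phi x = phi y -> x = y) /\
    (forall x, in_Sigma (phi x)).

Definition is_base {X : Type} (T : Topology X) (B : (X -> Prop) -> Prop) : Prop :=
  (forall V, B V -> is_open T V) /\
  (forall U x, is_open T U -> U x -> exists V, B V /\ V x /\ (forall y, V y -> U y)).

(* w(K) >= c : every base has cardinality at least that of R, i.e. R injects
   into the base (sets being compared extensionally). *)
Definition weight_ge_continuum {X : Type} (T : Topology X) : Prop :=
  forall B, is_base T B ->
    exists f : R -> (X -> Prop),
      (forall r, B (f r)) /\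
      (forall r s, (forall x, f r x <-> f s x) -> r = s).

Definition metrizable {X : Type} (T : Topology X) : Prop :=
  exists d : X -> X -> R,
    (forall x y, d x y = 0 <-> x = y) /\
    (forall x y, d x y = d y x) /\
    (forall x y z, d x z <= d x y + d y z) /\
    (forall U, is_open T U <->
       (forall x, U x -> exists eps, 0 < eps /\ forall y, d x y < eps -> U y)).

Definition CH : Prop :=
  forall A : R -> Prop,
    countable_set A \/
    exists f : R -> R, (forall r, A (f r)) /\ (forall r s, f r = f s -> r = s).

Record Banach := mkBanach {
  bcar :> Type;
  bzero : bcar;
  badd : bcar -> bcar -> bcar;
  bopp : bcar -> bcar;
  bscal : R -> bcar -> bcar;
  bnorm : bcar -> R;
  badd_assoc : forall x y z, badd x (badd y z) = badd (badd x y) z;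
  badd_comm : forall x y, badd x y = badd y x;
  badd_0 : forall x, badd x bzero = x;
  badd_opp : forall x, badd x (bopp x) = bzero;
  bscal_assoc : forall a b x, bscal a (bscal b x) = bscal (a * b) x;
  bscal_1 : forall x, bscal 1 x = x;
  bscal_distr_l : forall a x y, bscal a (badd x y) = badd (bscal a x) (bscal a y);
  bscal_distr_r : forall a b x, bscal (a + b) x = badd (bscal a x) (bscal b x);
  bnorm_eq0 : forall x, bnorm x = 0 -> x = bzero;
  bnorm_scal : forall a x, bnorm (bscal a x) = Rabs a * bnorm x;
  bnorm_triangle : forall x y, bnorm (badd x y) <= bnorm x + bnorm y;
  bcomplete : forall u : nat -> bcar,
    (forall eps, 0 < eps -> exists N, forall m n, (N <= m)%nat -> (N <= n)%nat ->
        bnorm (badd (u m) (bopp (u n))) < eps) ->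
    exists l, forall eps, 0 < eps -> exists N, forall n, (N <= n)%nat ->
        bnorm (badd (u n) (bopp l)) < eps
}.
Arguments bzero {_}. Arguments badd {_}. Arguments bopp {_}.
Arguments bscal {_}. Arguments bnorm {_}.

Definition c0 : Type := { x : nat -> R | Un_cv x 0 }.

Definition CK {X : Type} (T : Topology X) : Type :=
  { f : X -> R | continuous_real T f }.

(* i : c0 -> Z bounded linear; ||i x|| <= M ||x||_sup is unfolded as
   "for every bound r of |x n|, ||i x|| <= M r". *)
Definition bounded_linear_from_c0 (Z : Banach) (i : c0 -> Z) : Prop :=
  (forall x y s : c0,
      (forall n, proj1_sig s n = proj1_sig x n + proj1_sig y n) -> i s = badd (i x) (i y)) /\
  (forall (a : R) (x s : c0),
      (forall n, proj1_sig s n = a * proj1_sig x n) -> i s = bscal a (i x)) /\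
  (exists M, forall (x : c0) r, (forall n, Rabs (proj1_sig x n) <= r) -> bnorm (i x) <= M * r).

Definition bounded_linear_to_CK {X : Type} (T : Topology X) (Z : Banach)
  (q : Z -> CK T) : Prop :=
  (forall z1 z2 t, proj1_sig (q (badd z1 z2)) t = proj1_sig (q z1) t + proj1_sig (q z2) t) /\
  (forall a z t, proj1_sig (q (bscal a z)) t = a * proj1_sig (q z) t) /\
  (exists M, forall z t, Rabs (proj1_sig (q z) t) <= M * bnorm z).

Definition exact_c0_CK {X : Type} (T : Topology X) (Z : Banach)
  (i : c0 -> Z) (q : Z -> CK T) : Prop :=
  (forall x y, i x = i y -> x = y) /\
  (forall f : CK T, exists z, forall t, proj1_sig (q z) t = proj1_sig f t) /\
  (forall z, (exists x, i x = z) <-> (forall t, proj1_sig (q z) t = 0)).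

Definition closed_subspace (Z : Banach) (N : Z -> Prop) : Prop :=
  N bzero /\
  (forall x y, N x -> N y -> N (badd x y)) /\
  (forall a x, N x -> N (bscal a x)) /\
  (forall (u : nat -> Z) l, (forall n, N (u n)) ->
     (forall eps, 0 < eps -> exists K, forall n, (K <= n)%nat ->
        bnorm (badd (u n) (bopp l)) < eps) -> N l).

Definition complemented (Z : Banach) (M : Z -> Prop) : Prop :=
  exists N, closed_subspace Z N /\
    (forall z, M z -> N z -> z = bzero) /\
    (forall z, exists a b, M a /\ N b /\ z = badd a b).

Definition twisted_sum_c0_CK {X : Type} (T : Topology X) (Z : Banach)
  (i : c0 -> Z) (q : Z -> CK T) : Prop :=
  bounded_linear_from_c0 Z i /\ bounded_linear_to_CK T Z q /\ exact_c0_CK T Z i q.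

Definition nontrivial_twisted_sum_exists {X : Type} (T : Topology X) : Prop :=
  exists (Z : Banach) (i : c0 -> Z) (q : Z -> CK T),
    twisted_sum_c0_CK T Z i q /\ ~ complemented Z (fun z => exists x, i x = z).

(* Main.v *)
(** Let [W = Z^nat], a set of size continuum, and call a set small if [W] does not
    embed in it; small sets form a sigma-ideal (Koenig) stable under finite powers.
    Embed the Corson compactum [K] in a Sigma-product and measure an open set by
    the coordinates that do not vanish on it.  If [K] is large, then it contains
    disjoint large open sets [U n]: an indivisible large open set would give a
    maximal disjoint family of small open sets carrying a two-valued countably
    additive measure, which cannot exist on a set of size at most continuum.  A
    transfinite recursion of length [W] through sets [A] of coordinates such that
    restricting to [A] maps [K] into itself yields points [x b], [y b] of [K] with
    [x b] in a prescribed [U (idx b)] such that the sets of coordinates where [x b]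
    and [y b] differ are pairwise disjoint; hence the functionals
    [f |-> f (x b) - f (y b)] form a weak* null family.

    Together with the almost disjoint family of branches of the tree of finite
    sequences of integers, this family defines an operator from [C(K)] to bounded
    sequences modulo [c0], and the twisted sum is its pullback.  A splitting would
    give a bounded lift to bounded sequences.  The fibres of [idx : W -> nat] are
    chosen nonmeager in every open set (a Vitali-type partition), so any number of
    branches with distinct indices share an arbitrarily long initial segment; at
    the corresponding node the lift of a sum of disjoint bumps is large. *)

From Stdlib Require Import Reals List Lia Lra ZArith Classical ClassicalEpsilon.
From Stdlib Require Import FunctionalExtensionality PropExtensionality ProofIrrelevance.
From Stdlib Require Cantor.
From mathcomp Require classical_sets wochoice boolp.
Require Import Defs.
Open Scope R_scope.
#[local] Opaque Cantor.to_nat.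

(** * Injections and squares of infinite sets *)

(** A lift bounded by a constant is refuted by adding bumps with disjoint supports at a node lying
    beyond the thresholds of all the branches involved. Disjoint supports are the scarce resource:
    only a sequence of disjoint large open sets is constructed, so the branches can be sorted into
    no more than countably many classes. The thresholds form an arbitrary function [W -> nat] that
    depends on the splitting and is unknown when the classes are fixed; a counting argument does not
    control them. Category does: cutting a nonmeager class into countably many pieces by threshold
    leaves a piece that is dense in some cylinder, and this can be arranged for several classes in
    the same cylinder. Every branch needs its own pair of points, so the recursion must have length
    [W]. It does not stop because before each stage the coordinates already used, even after closing
    off, form a small set, while every [U n] has a large one. Cardinal numbers are avoided:
    smallness is the absence of an injection of [W], and comparability of sets does the rest. *)

Definition embeds {A B : Type} (S : A -> Prop) (T : B -> Prop) : Prop :=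
  exists f : A -> B, (forall a, S a -> T (f a)) /\
    (forall a a', S a -> S a' -> f a = f a' -> a = a').

Definition chain {T : Type} (F : (T -> Prop) -> Prop) : Prop :=
  forall A B, F A -> F B -> (forall x, A x -> B x) \/ (forall x, B x -> A x).

Lemma zorn_union {T : Type} (P : (T -> Prop) -> Prop) :
  (forall F, (forall A, F A -> P A) -> chain F -> P (fun x => exists A, F A /\ A x)) ->
  exists A, P A /\ forall B, P B -> (forall x, A x -> B x) -> forall x, B x -> A x.
Proof.
  intros H.
  destruct (classical_sets.Zorn_bigcup (P := P)) as [A [PA HA]].
  - intros F HF Fch.
    assert (P (fun x => exists A, F A /\ A x)) as HP.
    { apply H; [exact HF|]. intros A B FA FB. exact (Fch A B FA FB). }
    match goal with |- P ?Q => replace Q with (fun x => exists A, F A /\ A x) end; [exact HP|].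
    apply functional_extensionality; intro x. apply propositional_extensionality.
    split; [intros [B [FB Bx]]; exists B; assumption | intros [B FB Bx]; exists B; auto].
  - exists A; split; [exact PA|]. intros B PB AB x Bx.
    apply NNPP; intro nAx. apply (HA B); [|exact PB].
    split; [exact AB|intro BA; exact (nAx (BA x Bx))].
Qed.

Lemma choice_on {A B : Type} (b0 : B) (S : A -> Prop) (R : A -> B -> Prop) :
  (forall a, S a -> exists b, R a b) -> exists f : A -> B, forall a, S a -> R a (f a).
Proof.
  intros H. exists (fun a => epsilon (inhabits b0) (R a)).
  intros a Sa. apply epsilon_spec. auto.
Qed.

(** A maximal partial injection exhausts one of the two sides. The points [a0] and [b0] only serve
    as default values for choice. *)
Lemma embeds_total {A B : Type} (a0 : A) (b0 : B) (S : A -> Prop) (T : B -> Prop) :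
  embeds S T \/ embeds T S.
Proof.
  destruct (zorn_union (T := A * B) (fun G =>
    (forall p, G p -> S (fst p) /\ T (snd p)) /\
    (forall p q, G p -> G q -> (fst p = fst q <-> snd p = snd q)))) as [G [[G1 G2] Gmax]].
  { intros F HF Fch. split.
    - intros p [A' [FA Ap]]. exact (proj1 (HF A' FA) p Ap).
    - intros p q [A1 [F1 Ap]] [A2 [F2 Aq]].
      destruct (Fch A1 A2 F1 F2) as [s|s].
      + apply (proj2 (HF A2 F2)); auto.
      + apply (proj2 (HF A1 F1)); auto. }
  destruct (classic (forall a, S a -> exists b, G (a, b))) as [HS|HS].
  { left. destruct (choice_on b0 S (fun a b => G (a, b)) HS) as [f Hf].
    exists f; split.
    - intros a Sa. exact (proj2 (G1 _ (Hf a Sa))).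
    - intros a a' Sa Sa' E. exact (proj2 (G2 _ _ (Hf a Sa) (Hf a' Sa')) E). }
  destruct (classic (forall b, T b -> exists a, G (a, b))) as [HT|HT].
  { right. destruct (choice_on a0 T (fun b a => G (a, b)) HT) as [f Hf].
    exists f; split.
    - intros a Sa. exact (proj1 (G1 _ (Hf a Sa))).
    - intros a a' Sa Sa' E. exact (proj1 (G2 _ _ (Hf a Sa) (Hf a' Sa')) E). }
  exfalso.
  apply not_all_ex_not in HS as [a Ha]. apply imply_to_and in Ha as [Sa Ha].
  apply not_all_ex_not in HT as [b Hb]. apply imply_to_and in Hb as [Tb Hb].
  apply Ha. exists b.
  apply (Gmax (fun p => G p \/ p = (a, b))); [|intros x Gx; left; exact Gx|right; reflexivity].
  split.
  - intros p [Gp| ->]; [auto|simpl; auto].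
  - intros [p1 p2] [q1 q2] [Gp|Ep] [Gq|Eq].
    + apply G2; assumption.
    + injection Eq as -> ->. simpl. split; intros ->; exfalso; [apply Ha|apply Hb]; eauto.
    + injection Ep as -> ->. simpl. split; intros <-; exfalso; [apply Ha|apply Hb]; eauto.
    + injection Ep as -> ->. injection Eq as -> ->. simpl. tauto.
Qed.

(* Zorn's lemma is applied to injections [A * A -> A], viewed as graphs that
   extend Cantor's pairing of the summand [nat]. *)
Lemma embeds_square (T : Type) :
  exists f : (T + nat) * (T + nat) -> T + nat, forall p q, f p = f q -> p = q.
Proof.
  set (D := (T + nat)%type).
  set (G0 := fun q : (D * D) * D => exists m n,
         q = ((inr m, inr n), inr (Cantor.to_nat (m, n)))).
  (* Zorn's lemma also asks for the union of the empty chain. Since [ext] always adds Cantor's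
     pairing, the empty graph is admissible and [dom] always contains the summand [nat]. *)
  set (ext := fun (G : (D * D) * D -> Prop) q => G0 q \/ G q).
  set (dom := fun (G : (D * D) * D -> Prop) (a : D) => exists b c, ext G ((a, b), c)).
  set (P := fun G : (D * D) * D -> Prop =>
    (forall a b, dom G a -> dom G b -> exists c, ext G ((a, b), c)) /\
    (forall a b c, ext G ((a, b), c) -> dom G a /\ dom G b /\ dom G c) /\
    (forall p q, ext G p -> ext G q -> (fst p = fst q <-> snd p = snd q))).
  assert (dom0 : forall G n, dom G (inr n)).
  { intros G n. exists (inr 0%nat), (inr (Cantor.to_nat (n, 0%nat))). left. exists n, 0%nat. reflexivity. }
  assert (Hch : forall F, (forall A, F A -> P A) -> chain F -> P (fun x => exists A, F A /\ A x)).
  { intros F HF Fch. set (U := fun x => exists A, F A /\ A x).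
    destruct (classic (exists A, F A)) as [[A1 FA1]|Fempty].
    2: { assert (HU : forall q, ext U q -> G0 q).
         { intros q [H|[A [FA _]]]; [exact H|]. exfalso; eauto. }
         split; [|split].
         - intros a b [b' [c Hc]] [b2 [c2 Hc2]]. apply HU in Hc, Hc2.
           destruct Hc as [m [n E]], Hc2 as [m2 [n2 E2]].
           injection E as -> _ _. injection E2 as -> _ _.
           exists (inr (Cantor.to_nat (m, m2))). left. exists m, m2. reflexivity.
         - intros a b c H. apply HU in H as [m [n E]]. injection E as -> -> ->. auto.
         - intros p q Hp Hq. apply HU in Hp, Hq.
           destruct Hp as [m [n ->]], Hq as [m' [n' ->]]. simpl. split; intros E.
           + injection E as -> ->. reflexivity.
           + assert (E2 : Cantor.to_nat (m, n) = Cantor.to_nat (m', n')) by congruence.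
             apply Cantor.to_nat_inj in E2. injection E2 as -> ->. reflexivity. }
    assert (HU : forall p q, ext U p -> ext U q -> exists A, F A /\ ext A p /\ ext A q).
    { intros p q [Hp|[A [FA Hp]]] [Hq|[B [FB Hq]]].
      - exists A1; repeat split; [assumption|left; assumption|left; assumption].
      - exists B; repeat split; [assumption|left; assumption|right; assumption].
      - exists A; repeat split; [assumption|right; assumption|left; assumption].
      - destruct (Fch A B FA FB) as [s|s].
        + exists B; repeat split; [assumption|right; auto|right; auto].
        + exists A; repeat split; [assumption|right; auto|right; auto]. }
    assert (HV : forall A q, F A -> ext A q -> ext U q).
    { intros A q FA [H|H]; [left; exact H|right; exists A; auto]. }
    assert (HW : forall A a, F A -> dom A a -> dom U a).
    { intros A a FA [b [c H]]. exists b, c. eauto. }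
    split; [|split].
    - intros a b [b' [c Hc]] [b2 [c2 Hc2]].
      destruct (HU _ _ Hc Hc2) as [A [FA [Ha Hb]]].
      destruct (proj1 (HF A FA) a b) as [d Hd]; [exists b', c; exact Ha|exists b2, c2; exact Hb|].
      exists d. eauto.
    - intros a b c H. destruct (HU _ _ H H) as [A [FA [Ha _]]].
      destruct (proj1 (proj2 (HF A FA)) a b c Ha) as [h1 [h2 h3]]. repeat split; apply (HW A); assumption.
    - intros p q Hp Hq. destruct (HU _ _ Hp Hq) as [A [FA [Ha Hb]]].
      apply (proj2 (proj2 (HF A FA))); assumption. }
  destruct (zorn_union P Hch) as [G [[Gtot [Gdom Ginj]] Gmax]].
  set (A := dom G).
  destruct (choice_on (inr 0%nat) (fun p : D * D => A (fst p) /\ A (snd p))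
              (fun p c => ext G (p, c))) as [g Hg].
  { intros [a b] [Ha Hb]. destruct (Gtot a b Ha Hb) as [c Hc]. exists c; exact Hc. }
  assert (gA : forall a b, A a -> A b -> A (g (a, b))).
  { intros a b Ha Hb. apply (Gdom a b). apply Hg. split; assumption. }
  assert (ginj : forall a b a' b', A a -> A b -> A a' -> A b' ->
            g (a, b) = g (a', b') -> a = a' /\ b = b').
  { intros a b a' b' Ha Hb Ha' Hb' E.
    assert (E2 := proj2 (Ginj _ _ (Hg (a, b) (conj Ha Hb)) (Hg (a', b') (conj Ha' Hb'))) E).
    simpl in E2. injection E2; auto. }
  destruct (embeds_total (inr 0%nat : D) (inr 0%nat : D) A (fun d => ~ A d))
    as [[h [hA hinj]]|[h [hA hinj]]].
  - exfalso.
    (* [A] can be doubled: [A] together with [h A] carries a larger pairing, whose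
       new values are the [h (g (j, g (x, y)))] with a tag [j] in [nat]. *)
    set (hA' := fun d => exists a, A a /\ d = h a).
    set (tg := fun j x y => h (g (inr j, g (x, y)))).
    set (N := fun q : (D * D) * D => exists x y, A x /\ A y /\
       (q = ((x, h y), tg 0%nat x y) \/ q = ((h x, y), tg 1%nat x y) \/
        q = ((h x, h y), tg 2%nat x y))).
    set (B := fun q => G q \/ N q).
    assert (An : forall n, A (inr n)) by (intro n; apply dom0).
    assert (tgA : forall j x y, A x -> A y -> ~ A (tg j x y)).
    { intros j x y Hx Hy. apply hA. apply gA; auto. }
    assert (tginj : forall j x y j' x' y', A x -> A y -> A x' -> A y' ->
              tg j x y = tg j' x' y' -> j = j' /\ x = x' /\ y = y').
    { intros j x y j' x' y' Hx Hy Hx' Hy' E. unfold tg in E.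
      apply hinj in E; [|apply gA; auto|apply gA; auto].
      apply ginj in E; auto. destruct E as [E1 E2]. injection E1 as ->.
      apply ginj in E2; tauto. }
    assert (EB : forall q, ext B q <-> ext G q \/ N q) by (intro q; unfold ext, B; tauto).
    assert (domB : forall d, dom B d <-> A d \/ hA' d).
    { intros d; split.
      - intros [b [c H]]. apply EB in H as [H|[x [y [Hx [Hy H]]]]].
        + left. exists b, c. exact H.
        + destruct H as [E|[E|E]]; injection E as -> -> ->;
            [left; assumption|right|right]; exists x; auto.
      - intros [[b [c H]]|[a [Ha ->]]].
        + exists b, c. apply EB. left; exact H.
        + exists a, (tg 1%nat a a). apply EB. right. exists a, a. tauto. }
    assert (NA : forall q, N q -> ~ A (snd q) /\ ~ (A (fst (fst q)) /\ A (snd (fst q)))).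
    { intros q [x [y [Hx [Hy [->|[->| ->]]]]]]; simpl; split; try (apply tgA; assumption);
        intros [h1 h2]; first [exact (hA _ Hx h1)|exact (hA _ Hy h2)]. }
    assert (GA : forall q, ext G q -> A (snd q) /\ A (fst (fst q)) /\ A (snd (fst q))).
    { intros [[a b] c] H. simpl. apply Gdom in H. tauto. }
    assert (PB : P B).
    { split; [|split].
      - intros a b Ha Hb. apply domB in Ha, Hb.
        destruct Ha as [Ha|[x [Hx ->]]], Hb as [Hb|[y [Hy ->]]].
        + destruct (Gtot a b Ha Hb) as [c Hc]. exists c. apply EB; left; exact Hc.
        + exists (tg 0%nat a y). apply EB; right. exists a, y. tauto.
        + exists (tg 1%nat x b). apply EB; right. exists x, b. tauto.
        + exists (tg 2%nat x y). apply EB; right. exists x, y. tauto.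
      - intros a b c H. rewrite !domB. apply EB in H as [H|[x [y [Hx [Hy H]]]]].
        + apply GA in H. simpl in H. tauto.
        + assert (hA' (h x)) by (exists x; auto). assert (hA' (h y)) by (exists y; auto).
          assert (forall j, hA' (tg j x y)).
          { intro j. exists (g (inr j, g (x, y))). split; [apply gA; auto|reflexivity]. }
          destruct H as [E|[E|E]]; injection E as -> -> ->; auto.
      - intros p q Hp Hq. apply EB in Hp, Hq. destruct Hp as [Hp|Hp], Hq as [Hq|Hq].
        + apply Ginj; assumption.
        + apply GA in Hp. apply NA in Hq. split; intros E; exfalso; rewrite E in Hp; tauto.
        + apply NA in Hp. apply GA in Hq. split; intros E; exfalso; rewrite E in Hp; tauto.
        + destruct Hp as [x [y [Hx [Hy Ep]]]], Hq as [x' [y' [Hx' [Hy' Eq]]]].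
          destruct Ep as [->|[->| ->]], Eq as [->|[->| ->]]; simpl; split; intros E;
            try (apply tginj in E; auto; destruct E as [E1 [E2 E3]]; try discriminate; subst; reflexivity);
            injection E as E1 E2; subst;
            try (apply hinj in E1; auto); try (apply hinj in E2; auto); subst; try reflexivity;
            exfalso; match goal with Ha : A ?a, Hb : A (h ?a) |- _ => exact (hA a Ha Hb) end. }
    assert (HN : B ((h (inr 0%nat), inr 0%nat), tg 1%nat (inr 0%nat) (inr 0%nat))).
    { right. exists (inr 0%nat), (inr 0%nat). auto. }
    apply (Gmax B PB (fun x Gx => or_introl Gx)) in HN.
    destruct (GA _ (or_intror HN)) as [_ [H _]]. simpl in H. exact (hA _ (An 0%nat) H).
  (* Here the complement of [A] embeds in [A], so tags 0 and 1 give an injection [e] of all of [D]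
     into [A], and [g] pairs its values. *)
  - set (e := fun d => if excluded_middle_informative (A d)
                       then g (inr 0%nat, d) else g (inr 1%nat, h d)).
    assert (An : forall n, A (inr n)) by (intro n; apply dom0).
    assert (eA : forall d, A (e d)).
    { intros d. unfold e. destruct (excluded_middle_informative (A d)); apply gA; auto. }
    assert (einj : forall d d', e d = e d' -> d = d').
    { intros d d'. unfold e.
      destruct (excluded_middle_informative (A d)), (excluded_middle_informative (A d'));
        intros E; apply ginj in E; auto; destruct E as [E1 E2]; try discriminate; auto. }
    exists (fun p => g (e (fst p), e (snd p))).
    intros [a b] [a' b'] E. simpl in E. apply ginj in E; auto.
    destruct E as [E1 E2]. apply einj in E1, E2. congruence.
Qed.

(** * Small sets and a nonmeager partition *)

(* [W] stands for the continuum; the group structure of [Z] provides the translates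
   used in [shift_class_nonmeager]. *)
Definition W : Type := nat -> Z.

Definition big {A : Type} (S : A -> Prop) : Prop := embeds (fun _ : W => True) S.
Definition small {A : Type} (S : A -> Prop) : Prop := ~ big S.

Lemma big_embeds {A B : Type} (S : A -> Prop) (T : B -> Prop) :
  embeds S T -> big S -> big T.
Proof.
  intros [f [fT finj]] [g [gS ginj]]. exists (fun w => f (g w)). split; [auto|].
  intros a a' _ _ E. apply ginj; auto.
Qed.

Lemma small_embeds {A B : Type} (S : A -> Prop) (T : B -> Prop) :
  embeds S T -> small T -> small S.
Proof. intros H nT bS. exact (nT (big_embeds S T H bS)). Qed.

Lemma small_sub {A : Type} (S T : A -> Prop) : (forall a, S a -> T a) -> small T -> small S.
Proof. intros H. apply small_embeds. exists (fun a => a). auto. Qed.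

Lemma small_covered {A B : Type} (S : A -> Prop) (T : B -> Prop) (r : A -> B -> Prop) :
  (forall b, T b -> exists a, S a /\ r a b) ->
  (forall a b b', r a b -> r a b' -> b = b') -> small S -> small T.
Proof.
  intros H rf nS [f [fT finj]]. apply nS.
  destruct (H (f (fun _ => 0%Z)) (fT _ I)) as [a0 _].
  destruct (choice_on a0 T (fun b a => S a /\ r a b) H) as [g Hg].
  exists (fun w => g (f w)). split.
  - intros w _. apply Hg; auto.
  - intros w w' _ _ E. apply finj; auto.
    assert (h := proj2 (Hg _ (fT w I))). assert (h' := proj2 (Hg _ (fT w' I))).
    rewrite E in h. exact (rf _ _ _ h h').
Qed.

(* Koenig's theorem: [W] is in bijection with the sequences in [W], so a
   diagonal sequence avoids countably many small pieces. *)
Lemma small_Union {A : Type} (S : nat -> A -> Prop) :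
  (forall n, small (S n)) -> small (fun a => exists n, S n a).
Proof.
  intros HS [f [fS finj]].
  set (dec := fun (w : W) (n : nat) => (fun k => w (Cantor.to_nat (n, k))) : W).
  assert (H : forall n, exists z, forall w, S n (f w) -> dec w n <> z).
  { intros n. apply NNPP. intros Hn. apply (HS n).
    assert (H2 : forall z : W, True -> exists w, S n (f w) /\ dec w n = z).
    { intros z _. apply NNPP. intros Hz. apply Hn. exists z. intros w Sw E. apply Hz. eauto. }
    destruct (choice_on (fun _ => 0%Z) _ _ H2) as [g Hg].
    exists (fun z => f (g z)). split.
    - intros z _. apply Hg; exact I.
    - intros z z' _ _ E. apply finj in E; auto.
      destruct (Hg z I) as [_ <-], (Hg z' I) as [_ <-]. rewrite E. reflexivity. }
  destruct (choice_on (fun _ => 0%Z) (fun _ : nat => True) _ (fun n _ => H n)) as [z Hz].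
  set (w := fun m => let p := Cantor.of_nat m in z (fst p) (snd p)).
  destruct (fS w I) as [n Sn]. apply (Hz n I w Sn).
  apply functional_extensionality. intro k. unfold dec, w.
  rewrite Cantor.cancel_of_to. reflexivity.
Qed.

Lemma small_subsingleton {A : Type} (S : A -> Prop) :
  (forall a b, S a -> S b -> a = b) -> small S.
Proof.
  intros H [f [fS finj]].
  assert (E : (fun _ => 0%Z) = (fun _ => 1%Z) :> W).
  { apply finj; auto. }
  apply (f_equal (fun w => w 0%nat)) in E. discriminate.
Qed.

Lemma small_countable {A : Type} (S : A -> Prop) : countable_set S -> small S.
Proof.
  intros [g Hg].
  apply (small_sub _ (fun a => exists n, S a /\ g a = n)); [eauto|].
  apply small_Union. intro n. apply small_subsingleton.
  intros a b [Sa Ea] [Sb Eb]. apply Hg; congruence.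
Qed.

Lemma small_or {A : Type} (S T : A -> Prop) :
  small S -> small T -> small (fun a => S a \/ T a).
Proof.
  intros HS HT.
  apply (small_sub _ (fun a => exists n, match n with O => S a | _ => T a end)).
  - intros a [H|H]; [exists 0%nat|exists 1%nat]; exact H.
  - apply (small_Union (fun n a => match n with O => S a | _ => T a end)).
    intros [|n]; assumption.
Qed.

Lemma small_image {A B : Type} (S : A -> Prop) (f : A -> B) :
  small S -> small (fun b => exists a, S a /\ f a = b).
Proof.
  apply (small_covered S _ (fun a b => f a = b)); [auto|congruence].
Qed.

(** Adding a copy of [nat] makes [S] infinite but not large, so that [embeds_square] injects the
    square back into the sum. *)
Lemma small_square {A : Type} (S : A -> Prop) :
  small S -> small (fun p : A * A => S (fst p) /\ S (snd p)).
Proof.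
  intros HS.
  assert (HD : small (fun _ : {a | S a} + nat => True)).
  { apply (small_sub _ (fun d => (exists a : {a | S a}, True /\ inl a = d)
                              \/ (exists n : nat, True /\ inr n = d))).
    - intros [a|n] _; [left|right]; eauto.
    - apply small_or; apply small_image.
      + revert HS. apply small_embeds. exists (@proj1_sig _ _). split.
        * intros [a Sa] _. exact Sa.
        * intros [a Sa] [b Sb] _ _ E. simpl in E. subst. f_equal. apply proof_irrelevance.
      + apply small_countable. exists (fun n => n). auto. }
  destruct (embeds_square {a | S a}) as [f Hf].
  assert (HD2 : small (fun _ : ({a | S a} + nat) * ({a | S a} + nat) => True)).
  { revert HD. apply small_embeds. exists f. auto. }
  revert HD2.
  apply (small_covered _ _ (fun p q =>
    match p with (inl a, inl b) => q = (proj1_sig a, proj1_sig b) | _ => False end)).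
  - intros [a b] [Ha Hb]. simpl in Ha, Hb.
    exists (inl (exist _ a Ha), inl (exist _ b Hb)). auto.
  - intros [[a|n] [b|m]]; try tauto; congruence.
Qed.

Lemma small_prod {A B : Type} (S : A -> Prop) (T : B -> Prop) :
  small S -> small T -> small (fun p : A * B => S (fst p) /\ T (snd p)).
Proof.
  intros HS HT.
  assert (H : small (fun d : A + B => match d with inl a => S a | inr b => T b end)).
  { apply (small_sub _ (fun d => (exists a, S a /\ inl a = d) \/ (exists b, T b /\ inr b = d))).
    - intros [a|b] H; [left|right]; eauto.
    - apply small_or; apply small_image; assumption. }
  apply small_square in H. revert H.
  apply small_embeds. exists (fun p => (inl (fst p), inr (snd p))). split.
  - intros [a b]. auto.
  - intros [a b] [a' b'] _ _ E. simpl in E. congruence.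
Qed.

Lemma small_lists {A : Type} (S : A -> Prop) :
  small S -> small (fun l => forall a, In a l -> S a).
Proof.
  intros HS.
  apply (small_sub _ (fun l => exists n, length l = n /\ forall a, In a l -> S a)); [eauto|].
  apply small_Union. induction n as [|n IH].
  - apply small_subsingleton. intros [|] [|] [H _] [H' _]; simpl in *; congruence || lia.
  - assert (H := small_prod _ _ HS IH). revert H.
    apply (small_covered _ _ (fun p l => l = cons (fst p) (snd p))).
    + intros [|a l] [E Hl]; [discriminate|]. exists (a, l). simpl in *.
      split; [|reflexivity]. split; [auto|]. split; [lia|auto].
    + congruence.
Qed.

Lemma small_unions {A B : Type} (S : A -> Prop) (T : A -> B -> Prop) :
  small S -> (forall a, countable_set (T a)) -> small (fun b => exists a, S a /\ T a b).
Proof.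
  intros HS HT.
  assert (HN : small (fun _ : nat => True)).
  { apply small_countable. exists (fun n => n). auto. }
  assert (H : forall a, exists g : B -> nat, forall b b', T a b -> T a b' -> g b = g b' -> b = b').
  { intro a. exact (HT a). }
  destruct (choice _ H) as [g Hg].
  generalize (small_prod _ _ HS HN).
  apply (small_covered _ _ (fun p b => T (fst p) b /\ g (fst p) b = snd p)).
  - intros b [a [Sa Tb]]. exists (a, g a b). auto.
  - intros [a n] b b' [h1 h2] [h3 h4]. simpl in *. apply (Hg a); congruence.
Qed.

(** * Well orders of the continuum *)

Lemma well_order_exists (T : Type) :
  exists lt : T -> T -> Prop, well_founded lt /\ (forall a b, lt a b \/ a = b \/ lt b a).
Proof.
  (* The well-ordering principle concerns types with decidable equality; [boolp.Peq] supplies one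
     classically. *)
  revert T. apply boolp.Peq. intros T.
  destruct (wochoice.well_ordering_principle T) as [R HR].
  assert (Hmin : forall A : eqtype.Equality.sort T -> Prop, (exists x, A x) ->
            exists z, A z /\ (forall x, A x -> R z x = true) /\
            (forall y, A y -> (forall x, A x -> R y x = true) -> z = y)).
  { intros A [x Ax].
    set (p := fun y => if excluded_middle_informative (A y) then true else false).
    assert (Hp : forall y, p y = true <-> A y).
    { intro y. unfold p. destruct (excluded_middle_informative (A y)); split; auto; discriminate. }
    destruct (HR p) as [z [[z1 z2] z3]].
    - exists x. apply Hp. exact Ax.
    - exists z. split; [apply Hp; exact z1|split].
      + intros y Ay. apply z2. apply Hp. exact Ay.
      + intros y Ay Hy. apply z3. split; [apply Hp; exact Ay|].
        intros w pw. apply Hy. apply Hp. exact pw. }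
  exists (fun a b => R b a <> true). split.
  - intro a. apply NNPP. revert a. apply not_ex_all_not. intros Hn.
    destruct (Hmin _ Hn) as [z [z1 [z2 _]]]. apply z1. constructor.
    intros y Ryz. apply NNPP. intros ny. apply Ryz. apply z2. exact ny.
  - intros a b. apply NNPP. intros Hn.
    assert (Rab : R a b = true) by (apply NNPP; tauto).
    assert (Rba : R b a = true) by (apply NNPP; tauto).
    assert (Rxx : forall x, R x x = true).
    { intro x. destruct (Hmin (fun y => y = x)) as [z [-> [h _]]]; auto. exists x. reflexivity. }
    destruct (Hmin (fun x => x = a \/ x = b)) as [z [_ [_ h]]]; [exists a; auto|].
    apply Hn. right; left. rewrite <- (h a), <- (h b); auto; intros x [-> | ->]; auto.
Qed.

(** Passage to the initial ordinal: if some initial segment is large, [W] embeds by [g] in the least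
    such segment, and the order pulled back along [g] has small initial segments. *)
Lemma small_initial_segments :
  exists lt : W -> W -> Prop, well_founded lt /\
    (forall a b, lt a b \/ a = b \/ lt b a) /\
    (forall b, small (fun a => lt a b)).
Proof.
  assert (H : exists lt : W -> W -> Prop, well_founded lt /\
                (forall a b, lt a b \/ a = b \/ lt b a)).
  { apply well_order_exists. }
  destruct H as [lt [wf tot]].
  destruct (classic (forall b, small (fun a => lt a b))) as [Hs|Hb]; [eauto|].
  assert (Hm : exists b, big (fun a => lt a b) /\ forall c, lt c b -> small (fun a => lt a c)).
  { apply NNPP. intros Hn. apply Hb. intro b.
    induction b as [b IH] using (well_founded_induction wf).
    intro Bb. apply Hn. eauto. }
  destruct Hm as [b [[g [gb ginj]] Hc]].
  exists (fun u v => lt (g u) (g v)). split; [|split].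
  - intro u. remember (g u) as c eqn:E. revert u E.
    induction c as [c IH] using (well_founded_induction wf).
    intros u ->. constructor. intros v Hv. eapply IH; eauto.
  - intros u v. destruct (tot (g u) (g v)) as [h|[h|h]]; auto.
  - intro v. generalize (Hc (g v) (gb v I)). apply small_embeds.
    exists g. auto.
Qed.

(** * A Vitali-type partition of the integer sequences *)

Definition eventual_shift (c : Z) (v b : W) : Prop :=
  exists N, forall i, (N <= i)%nat -> b i = (v i + c)%Z.

(** [d b] is the eventual shift of [b] from a chosen representative of its class. It follows
    translations exactly and ignores changes of finitely many terms, the two operations used to move
    classes around. *)
Lemma shift_index :
  exists d : W -> Z,
    forall b b' c, eventual_shift c b b' -> d b' = (d b + c)%Z.
Proof.
  set (E := fun b b' => exists c, eventual_shift c b b').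
  assert (Erefl : forall b, E b b).
  { intro b. exists 0%Z, 0%nat. intros. lia. }
  set (v := fun b => epsilon (inhabits b) (fun b' => E b' b)).
  assert (Hv : forall b, E (v b) b).
  { intro b. apply (epsilon_spec (inhabits b) (fun b' => E b' b)). exists b. apply Erefl. }
  assert (vE : forall b b' c, eventual_shift c b b' -> v b = v b').
  { intros b b' c [N Hc]. unfold v.
    (* The choice operator sees only the predicate, and equivalent sequences define the same one,
       hence the same representative. *)
    assert (Q : (fun a => E a b) = (fun a => E a b')).
    { apply functional_extensionality. intro a. apply propositional_extensionality. split.
      - intros [e [M He]]. exists (e + c)%Z, (max M N). intros i Hi.
        rewrite Hc by lia. rewrite He by lia. lia.
      - intros [e [M He]]. exists (e - c)%Z, (max M N). intros i Hi.
        specialize (Hc i ltac:(lia)). specialize (He i ltac:(lia)). lia. }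
    rewrite Q. f_equal. apply proof_irrelevance. }
  destruct (choice _ Hv) as [d Hd].
  exists d. intros b b' c Hc.
  assert (Q := vE _ _ _ Hc).
  destruct Hc as [N Hc], (Hd b) as [M HM], (Hd b') as [M' HM'].
  set (i := (N + M + M')%nat).
  specialize (Hc i ltac:(lia)). specialize (HM i ltac:(lia)). specialize (HM' i ltac:(lia)).
  rewrite Q in HM. lia.
Qed.

Definition agree (n : nat) (b b' : W) : Prop := forall i, (i < n)%nat -> b i = b' i.

(** The Baire category theorem inside the cylinder of [t] of length [l], in which the hypothesis
    makes every [S k] nowhere dense. *)
Lemma baire_W (S : nat -> W -> Prop) (t : W) (l : nat) :
  (forall k w n, agree l t w -> (l <= n)%nat ->
     exists w' n', agree n w w' /\ (n <= n')%nat /\ forall b, agree n' w' b -> ~ S k b) ->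
  exists b, forall k, ~ S k b.
Proof.
  intros H.
  set (good := fun p : W * nat => agree l t (fst p) /\ (l <= snd p)%nat).
  set (ref := fun k (p q : W * nat) => agree (snd p) (fst p) (fst q) /\
           (snd p < snd q)%nat /\ forall b, agree (snd q) (fst q) b -> ~ S k b).
  assert (H2 : forall x : nat * (W * nat), exists q, good (snd x) -> ref (fst x) (snd x) q).
  { intros [k [w n]]. simpl. destruct (classic (good (w, n))) as [[g1 g2]|g].
    - simpl in *. destruct (H k w n g1 g2) as [w' [n' [h1 [h2 h3]]]].
      (* The extra unit makes the lengths strictly increase, so that the limit is defined
         everywhere. *)
      exists (w', Datatypes.S n'). intros _. repeat split; simpl; auto.
      + lia.
      + intros b Hb. apply h3. intros i Hi. apply Hb. lia.
    - exists (w, n). tauto. }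
  destruct (choice _ H2) as [step Hstep].
  set (p := fix p k := match k with O => (t, l) | Datatypes.S k => step (k, p k) end).
  assert (pg : forall k, good (p k)).
  { induction k as [|k IH].
    - split; simpl; [intros i _; reflexivity|lia].
    - destruct (Hstep (k, p k) IH) as [h1 [h2 _]]. simpl in h1, h2.
      destruct IH as [g1 g2]. change (p (Datatypes.S k)) with (step (k, p k)). split.
      + intros i Hi. rewrite g1 by assumption. apply h1. lia.
      + lia. }
  assert (pr : forall k, ref k (p k) (p (Datatypes.S k))).
  { intro k. exact (Hstep (k, p k) (pg k)). }
  assert (pn : forall k, (k <= snd (p k))%nat).
  { induction k as [|k IH]; [lia|]. destruct (pr k) as [_ [h _]]. lia. }
  assert (pm : forall j k, agree (snd (p k)) (fst (p k)) (fst (p (j + k)%nat)) /\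
                 (snd (p k) <= snd (p (j + k)%nat))%nat).
  { induction j as [|j IH]; intros k.
    - split; [intros i _; reflexivity|simpl; lia].
    - destruct (IH k) as [h1 h2], (pr (j + k)%nat) as [h3 [h4 _]].
      change (Datatypes.S j + k)%nat with (Datatypes.S (j + k)). split; [|lia].
      intros i Hi. rewrite h1 by assumption. apply h3. lia. }
  (* Stage [S i] has length greater than [i], so coordinate [i] is final there. *)
  exists (fun i => fst (p (Datatypes.S i)) i). intros k.
  destruct (pr k) as [_ [_ h]]. apply h.
  intros i Hi. destruct (Nat.le_gt_cases k i) as [c|c].
  - replace (Datatypes.S i) with ((i - k) + Datatypes.S k)%nat by lia.
    apply (proj1 (pm _ _)). exact Hi.
  - symmetry. replace (Datatypes.S k) with ((k - i) + Datatypes.S i)%nat by lia.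
    apply (proj1 (pm _ _)). specialize (pn (Datatypes.S i)). lia.
Qed.

(* If one class were meager above [t], then, translating and changing an initial
   segment, so would be all of them, but countably many classes cover [W]. *)
Lemma shift_class_nonmeager (d : W -> Z) :
  (forall b b' c, eventual_shift c b b' -> d b' = (d b + c)%Z) ->
  forall (c : Z) (m : W -> nat) (t : W) (l : nat),
  exists M w n, agree l t w /\ (l <= n)%nat /\
    forall w' n', agree n w w' -> (n <= n')%nat ->
      exists b, agree n' w' b /\ d b = c /\ (m b <= M)%nat.
Proof.
  intros Hd c m t l. apply NNPP. intros Hn.
  set (phi := fun b : W => (fun i => if (i <? l)%nat then t i else b i + (c - d b))%Z).
  set (psi := fun (e : Z) (b : W) => (fun i => if (i <? l)%nat then t i else b i + e)%Z).
  (* [psi e b] has index [c] when [d b = c - e]. The number [k] codes [e], by its positive and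
     negative parts, and the threshold of [psi e b]. The sets so numbered cover [W], by
     [e = c - d b], so a point outside all of them is absurd. *)
  assert (Hb : exists b, forall k,
    ~ (exists e, k = Cantor.to_nat (Z.to_nat e, Cantor.to_nat (Z.to_nat (- e), m (psi e b)))
         /\ d b = (c - e)%Z)).
  { apply (baire_W (fun k b => exists e,
       k = Cantor.to_nat (Z.to_nat e, Cantor.to_nat (Z.to_nat (- e), m (psi e b)))
         /\ d b = (c - e)%Z) t l).
    intros k w n tw ln.
    set (x := fst (Cantor.of_nat k)). set (y := fst (Cantor.of_nat (snd (Cantor.of_nat k)))).
    set (M := snd (Cantor.of_nat (snd (Cantor.of_nat k)))).
    set (e := (Z.of_nat x - Z.of_nat y)%Z).
    assert (Hn2 : exists w' n', agree n (psi e w) w' /\ (n <= n')%nat /\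
      ~ exists b, agree n' w' b /\ d b = c /\ (m b <= M)%nat).
    { apply NNPP. intros Hc. apply Hn. exists M, (psi e w), n. split; [|split; [exact ln|]].
      - intros i Hi. unfold psi. apply Nat.ltb_lt in Hi. rewrite Hi. reflexivity.
      - intros w' n' h1 h2. apply NNPP. intros h3. apply Hc. exists w', n'. auto. }
    destruct Hn2 as [w' [n' [h1 [h2 h3]]]].
    (* The avoiding cylinder is translated back by [e], with the first [l] values of [w]
       restored. *)
    exists (fun i => if (i <? l)%nat then w i else (w' i - e)%Z), n'.
    split; [|split; [exact h2|]].
    - intros i Hi. destruct (i <? l)%nat eqn:Q; [reflexivity|].
      rewrite <- (h1 i Hi). unfold psi. rewrite Q. lia.
    - intros b hb [e' [Ek Ed]].
      assert (Ex : x = Z.to_nat e') by (unfold x; rewrite Ek, Cantor.cancel_of_to; reflexivity).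
      assert (Ey : y = Z.to_nat (- e')).
      { unfold y. rewrite Ek, Cantor.cancel_of_to. simpl. rewrite Cantor.cancel_of_to. reflexivity. }
      assert (EM : M = m (psi e' b)).
      { unfold M. rewrite Ek, Cantor.cancel_of_to. simpl. rewrite Cantor.cancel_of_to. reflexivity. }
      assert (e' = e) by lia. subst e'.
      apply h3. exists (psi e b). split; [|split].
      + intros i Hi. unfold psi. specialize (hb i Hi). cbv beta in hb.
        destruct (i <? l)%nat eqn:Q.
        * apply Nat.ltb_lt in Q. rewrite <- (h1 i) by lia. unfold psi.
          apply Nat.ltb_lt in Q. rewrite Q. reflexivity.
        * lia.
      + rewrite (Hd b (psi e b) e); [lia|]. exists l. intros i Hi. unfold psi.
        apply Nat.ltb_ge in Hi. rewrite Hi. reflexivity.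
      + lia. }
  destruct Hb as [b Hb].
  eapply Hb. exists (c - d b)%Z. split; [reflexivity|lia].
Qed.

(** Cylinders are shrunk once for each [j < k], until the members of class [j] with threshold at
    most [M j] are dense in a common one. The bounds are fixed before the points are chosen, so
    density allows the shared segment to be longer than all of them. *)
Lemma thick_partition :
  exists idx : W -> nat, forall (m : W -> nat) (k : nat),
    exists (b : nat -> W) (L : nat), forall j, (j < k)%nat ->
      idx (b j) = j /\ (m (b j) <= L)%nat /\ agree L (b 0%nat) (b j).
Proof.
  destruct shift_index as [d Hd].
  (* Negative indices all go to class 0, which only enlarges it. *)
  exists (fun b => Z.to_nat (d b)). intros m k.
  assert (H : exists w n, forall j, (j < k)%nat -> exists M,
     forall w' n', agree n w w' -> (n <= n')%nat ->
      exists b, agree n' w' b /\ d b = Z.of_nat j /\ (m b <= M)%nat).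
  { induction k as [|k [w [n IH]]].
    - exists (fun _ => 0%Z), 0%nat. intros j Hj. lia.
    - destruct (shift_class_nonmeager d Hd (Z.of_nat k) m w n) as [M [w2 [n2 [h1 [h2 h3]]]]].
      exists w2, n2. intros j Hj. destruct (Nat.eq_dec j k) as [->|Hne]; [eauto|].
      destruct (IH j ltac:(lia)) as [M' HM']. exists M'. intros w' n' g1 g2.
      apply HM'; [|lia]. intros i Hi. rewrite h1 by assumption. apply g1. lia. }
  destruct H as [w [n H]].
  destruct (choice_on 0%nat _ _ H) as [M HM].
  assert (HL : exists L, forall j, (j < k)%nat -> (M j <= L)%nat).
  { clear. induction k as [|k [L HL]].
    - exists 0%nat. lia.
    - exists (max L (M k)). intros j Hj.
      destruct (Nat.eq_dec j k) as [->|Hne]; [lia|]. specialize (HL j ltac:(lia)). lia. }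
  destruct HL as [L HL].
  assert (H2 : forall j, (j < k)%nat -> exists b,
             agree (max n L) w b /\ d b = Z.of_nat j /\ (m b <= M j)%nat).
  { intros j Hj. apply (HM j Hj); [intros i _; reflexivity|lia]. }
  destruct (choice_on w _ _ H2) as [b Hb].
  exists b, (max n L). intros j Hj.
  destruct (Hb j Hj) as [h1 [h2 h3]], (Hb 0%nat ltac:(lia)) as [g1 _].
  split; [rewrite h2; apply Nat2Z.id|split].
  - specialize (HL j Hj). lia.
  - intros i Hi. rewrite <- g1, <- h1 by assumption. reflexivity.
Qed.

(** * Coordinates of a Corson compactum *)

Lemma pred_ext {A : Type} (P Q : A -> Prop) : (forall a, P a <-> Q a) -> P = Q.
Proof.
  intros H. apply functional_extensionality. intro a. apply propositional_extensionality. auto.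
Qed.

Lemma is_open_local {X : Type} (T : Topology X) (U : X -> Prop) :
  (forall x, U x -> exists V, is_open T V /\ V x /\ (forall y, V y -> U y)) -> is_open T U.
Proof.
  intros H.
  rewrite (pred_ext U (fun x => exists V, (is_open T V /\ forall y, V y -> U y) /\ V x)).
  - apply open_union. tauto.
  - intro x. split.
    + intros Ux. destruct (H x Ux) as [V h]. exists V. tauto.
    + intros [V [[_ h] Vx]]. auto.
Qed.

Lemma inv_succ_pos (k : nat) : 0 < / (INR k + 1).
Proof. apply Rinv_0_lt_compat. generalize (pos_INR k). lra. Qed.

Lemma inv_succ_lt (e : R) : 0 < e -> exists k, / (INR k + 1) < e.
Proof.
  intros He. destruct (archimed_cor1 e He) as [N [h1 h2]]. exists N.
  apply Rle_lt_trans with (2 := h1). apply Rinv_le_contravar; [apply lt_0_INR; exact h2|lra].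
Qed.

Definition rational (n : nat) : R :=
  let p := Cantor.of_nat n in let q := Cantor.of_nat (snd p) in
  (INR (fst p) - INR (fst q)) / (INR (snd q) + 1).

Lemma rational_dense (x e : R) : 0 < e -> exists n, Rabs (x - rational n) < e.
Proof.
  intros He. destruct (inv_succ_lt e He) as [k Hk].
  assert (Hp : 0 < INR k + 1) by (generalize (pos_INR k); lra).
  set (z := up (x * (INR k + 1))).
  destruct (archimed (x * (INR k + 1))) as [h1 h2]. fold z in h1, h2.
  exists (Cantor.to_nat (Z.to_nat z, Cantor.to_nat (Z.to_nat (- z), k))).
  unfold rational. rewrite Cantor.cancel_of_to. cbn [fst snd].
  rewrite Cantor.cancel_of_to. cbn [fst snd].
  rewrite !INR_IZR_INZ.
  replace (IZR (Z.of_nat (Z.to_nat z)) - IZR (Z.of_nat (Z.to_nat (- z)))) with (IZR z).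
  2: { rewrite <- minus_IZR. f_equal. lia. }
  rewrite <- INR_IZR_INZ.
  replace (x - IZR z / (INR k + 1)) with ((x * (INR k + 1) - IZR z) * / (INR k + 1)) by (field; lra).
  rewrite Rabs_mult, (Rabs_right (/ (INR k + 1))) by (generalize (inv_succ_pos k); lra).
  apply Rle_lt_trans with (2 := Hk).
  rewrite <- (Rmult_1_l (/ (INR k + 1))) at 2.
  apply Rmult_le_compat_r; [generalize (inv_succ_pos k); lra|].
  apply Rabs_le. lra.
Qed.

Lemma continuous_lipschitz {X : Type} (T : Topology X) f (h : R -> R) C :
  0 <= C -> (forall a b, Rabs (h a - h b) <= C * Rabs (a - b)) ->
  continuous_real T f -> continuous_real T (fun x => h (f x)).
Proof.
  intros HC Hh fc x e He. destruct (fc x (e * / (C + 1))) as [U [Uo [Ux HU]]].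
  { apply Rmult_lt_0_compat; [exact He|apply Rinv_0_lt_compat; lra]. }
  exists U. split; [exact Uo|]. split; [exact Ux|]. intros y Uy.
  apply Rle_lt_trans with (1 := Hh _ _).
  apply Rle_lt_trans with ((C + 1) * Rabs (f y - f x)).
  - apply Rmult_le_compat_r; [apply Rabs_pos|lra].
  - replace e with ((C + 1) * (e * / (C + 1))) by (field; lra).
    apply Rmult_lt_compat_l; [lra|auto].
Qed.

Lemma continuous_Rmax {X : Type} (T : Topology X) f g :
  continuous_real T f -> continuous_real T g -> continuous_real T (fun x => Rmax (f x) (g x)).
Proof.
  intros fc gc x e He.
  destruct (fc x e He) as [U [Uo [Ux HU]]], (gc x e He) as [V [Vo [Vx HV]]].
  exists (fun y => U y /\ V y). split; [apply open_inter; assumption|].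
  split; [auto|]. intros y [Uy Vy]. specialize (HU y Uy). specialize (HV y Vy).
  apply Rabs_def2 in HU, HV.
  apply Rabs_def1; unfold Rmax; repeat destruct Rle_dec; lra.
Qed.

Section Corson.
Context {K I : Type} (T : Topology K) (phi : K -> I -> R).
Context (Tcomp : compact T) (phi_cont : continuous_into_product T phi).
Context (phi_inj : forall x y, phi x = phi y -> x = y).
Context (phi_sigma : forall x, in_Sigma (phi x)).

Lemma open_coord_near i a e : is_open T (fun x => Rabs (phi x i - a) < e).
Proof.
  apply (phi_cont (fun z => Rabs (z i - a) < e)).
  intros z Hz. exists (i :: nil), (e - Rabs (z i - a)). split; [lra|].
  intros y Hy. specialize (Hy i (or_introl eq_refl)).
  replace (y i - a) with ((y i - z i) + (z i - a)) by ring.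
  generalize (Rabs_triang (y i - z i) (z i - a)). lra.
Qed.

Lemma open_coord_far i a e : is_open T (fun x => e < Rabs (phi x i - a)).
Proof.
  apply (phi_cont (fun z => e < Rabs (z i - a))).
  intros z Hz. exists (i :: nil), (Rabs (z i - a) - e). split; [lra|].
  intros y Hy. specialize (Hy i (or_introl eq_refl)).
  replace (z i - a) with (- (y i - z i) + (y i - a)) in Hy, Hz by ring.
  generalize (Rabs_triang (- (y i - z i)) (y i - a)). rewrite Rabs_Ropp.
  replace (- (y i - z i) + (y i - a)) with (z i - a) in * by ring. lra.
Qed.

Lemma open_coord_lt i q : is_open T (fun x => phi x i < q).
Proof.
  apply is_open_local. intros x Hx. exists (fun y => Rabs (phi y i - phi x i) < q - phi x i).
  split; [apply open_coord_near|split].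
  - rewrite Rminus_diag, Rabs_R0. lra.
  - intros y Hy. apply Rabs_def2 in Hy. lra.
Qed.

Lemma open_coord_gt i q : is_open T (fun x => q < phi x i).
Proof.
  apply is_open_local. intros x Hx. exists (fun y => Rabs (phi y i - phi x i) < phi x i - q).
  split; [apply open_coord_near|split].
  - rewrite Rminus_diag, Rabs_R0. lra.
  - intros y Hy. apply Rabs_def2 in Hy. lra.
Qed.

Lemma open_coord_neq i q : is_open T (fun x => phi x i <> q).
Proof.
  rewrite (pred_ext _ (fun x => 0 < Rabs (phi x i - q))); [apply open_coord_far|].
  intro x. split.
  - intros h. apply Rabs_pos_lt. lra.
  - intros h E. rewrite E, Rminus_diag, Rabs_R0 in h. lra.
Qed.

Lemma phi_neq x y : x <> y -> exists i, phi x i <> phi y i.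
Proof.
  intros h. apply not_all_ex_not. intros H. apply h. apply phi_inj.
  apply functional_extensionality. exact H.
Qed.

(** By compactness the topology of [K] is the one induced by [phi]: [V] and the open sets where some
    coordinate is far from that of [x] cover [K], and a finite subcover yields the box. *)
Lemma box_nbhd V x : is_open T V -> V x ->
  exists (l : list I) e, 0 < e /\ forall y, (forall i, In i l -> Rabs (phi y i - phi x i) < e) -> V y.
Proof.
  intros HV Vx.
  destruct (Tcomp (fun U => U = V \/ exists i d, 0 < d /\ U = fun y => d < Rabs (phi y i - phi x i)))
    as [L [HL Lc]].
  - intros U [->|[i [d [_ ->]]]]; [exact HV|apply open_coord_far].
  - intro y. destruct (classic (V y)) as [Vy|nV]; [exists V; auto|].
    destruct (phi_neq y x) as [i Hi]; [congruence|].
    assert (0 < Rabs (phi y i - phi x i)) by (apply Rabs_pos_lt; lra).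
    exists (fun z => Rabs (phi y i - phi x i) / 2 < Rabs (phi z i - phi x i)).
    split; [right; exists i, (Rabs (phi y i - phi x i) / 2); split; [lra|reflexivity]|lra].
  - assert (H : exists (l : list I) e, 0 < e /\
      forall y, (forall i, In i l -> Rabs (phi y i - phi x i) < e) ->
                forall U, In U L -> U y -> V y).
    { clear Lc. induction L as [|U L IH].
      - exists nil, 1. split; [lra|]. intros y _ U [].
      - destruct IH as [l [e [He IH]]]; [intros U' h; apply HL; right; exact h|].
        destruct (HL U (or_introl eq_refl)) as [->|[i [d [Hd ->]]]].
        + exists l, e. split; [exact He|]. intros y Hy U [<-|hU] Uy; eauto.
        + exists (i :: l), (Rmin e d). split; [apply Rmin_glb_lt; assumption|].
          intros y Hy U [<-|hU] Uy.
          * exfalso. specialize (Hy i (or_introl eq_refl)). generalize (Rmin_r e d). lra.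
          * apply (IH y) with U; auto. intros j Hj. specialize (Hy j (or_intror Hj)).
            generalize (Rmin_l e d). lra. }
    destruct H as [l [e [He H]]]. exists l, e. split; [exact He|].
    intros y Hy. destruct (Lc y) as [U [hU Uy]]. eauto.
Qed.

Lemma open_box l x d : is_open T (fun y => forall i, In i l -> Rabs (phi y i - phi x i) < d).
Proof.
  induction l as [|i l IH].
  - replace (fun y => forall i, In i nil -> Rabs (phi y i - phi x i) < d) with (fun _ : K => True).
    + apply open_full.
    + apply pred_ext. simpl. tauto.
  - replace (fun y => forall j, In j (i :: l) -> Rabs (phi y j - phi x j) < d)
      with (fun y => Rabs (phi y i - phi x i) < d /\
                     (forall i, In i l -> Rabs (phi y i - phi x i) < d)).
    + apply open_inter; [apply open_coord_near|exact IH].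
    + apply pred_ext. intro y. split; [|simpl; auto]. intros [h1 h2] j [<-|hj]; auto.
Qed.

(** Finitely many boxes on which [f] oscillates little cover [K], and two points that agree on the
    coordinates of these boxes lie in the same ones. This is what turns disjoint sets of differing
    coordinates into a weak* null family. *)
Lemma finite_dependence f e : continuous_real T f -> 0 < e ->
  exists l : list I, forall x y, (forall i, In i l -> phi x i = phi y i) -> Rabs (f x - f y) < e.
Proof.
  intros fc He.
  destruct (Tcomp (fun U => exists x l d, 0 < d /\
     U = (fun y => forall i, In i l -> Rabs (phi y i - phi x i) < d) /\ is_open T U /\
     forall y, U y -> Rabs (f y - f x) < e / 2)) as [L [HL Lc]].
  - intros U [x [l [d [_ [_ [h _]]]]]]. exact h.
  - intro x. destruct (fc x (e / 2)) as [V [Vo [Vx HV]]]; [lra|].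
    destruct (box_nbhd V x Vo Vx) as [l [d [Hd Hl]]].
    exists (fun y => forall i, In i l -> Rabs (phi y i - phi x i) < d). split.
    + exists x, l, d. split; [exact Hd|]. split; [reflexivity|]. split; [apply open_box|auto].
    + intros i _. rewrite Rminus_diag, Rabs_R0. exact Hd.
  - assert (H : exists l : list I, forall x y, (forall i, In i l -> phi x i = phi y i) ->
              forall U, In U L -> U x -> Rabs (f x - f y) < e).
    { clear Lc. induction L as [|U L IH].
      - exists nil. intros x y _ U [].
      - destruct IH as [l IH]; [intros U' h; apply HL; right; exact h|].
        destruct (HL U (or_introl eq_refl)) as [c [l' [d [Hd [EU [_ HU]]]]]].
        exists (l ++ l'). intros x y Hxy U' [<-|hU] Ux.
        + assert (Uy : U y).
          { rewrite EU in *. intros i Hi. rewrite <- Hxy; [auto|]. apply in_or_app; auto. }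
          apply HU in Ux, Uy. apply Rabs_def2 in Ux, Uy. apply Rabs_def1; lra.
        + apply (IH x y) with U'; auto. intros i Hi. apply Hxy. apply in_or_app; auto. }
    destruct H as [l H]. exists l. intros x y Hxy. destruct (Lc x) as [U [hU Ux]]. eauto.
Qed.

Lemma urysohn U x y : is_open T U -> U x -> x <> y ->
  exists f, continuous_real T f /\ (forall z, 0 <= f z <= 1) /\ f x = 1 /\ f y = 0 /\
    forall z, ~ U z -> f z = 0.
Proof.
  intros Uo Ux Hxy.
  (* The second condition is open, holds at [x] and fails at [y], so it keeps [y] out of the box. *)
  destruct (box_nbhd (fun z => U z /\ exists i, Rabs (phi z i - phi x i) < Rabs (phi y i - phi x i)) x)
    as [l [e [He Hl]]].
  - apply open_inter; [exact Uo|]. apply is_open_local. intros z [i Hi].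
    exists (fun z => Rabs (phi z i - phi x i) < Rabs (phi y i - phi x i)).
    split; [apply open_coord_near|]. split; [exact Hi|eauto].
  - split; [exact Ux|]. destruct (phi_neq y x) as [i Hi]; [congruence|]. exists i.
    rewrite Rminus_diag, Rabs_R0. apply Rabs_pos_lt. lra.
  - set (g := fun z => fold_right (fun i m => Rmax m (Rabs (phi z i - phi x i))) 0 l).
    assert (gc : continuous_real T g).
    { unfold g. clear - phi_cont. induction l as [|i l IH]; simpl.
      - intros z d Hd. exists (fun _ => True). split; [apply open_full|]. split; [auto|].
        intros. rewrite Rminus_diag, Rabs_R0. exact Hd.
      - apply (continuous_Rmax T _ _ IH).
        apply (continuous_lipschitz T (fun z => phi z i) (fun r => Rabs (r - phi x i)) 1);
          [lra| |intros z d Hd; exists (fun w => Rabs (phi w i - phi z i) < d)].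
        + intros a b. rewrite Rmult_1_l.
          apply Rle_trans with (1 := Rabs_triang_inv2 _ _).
          right. f_equal. ring.
        + split; [apply open_coord_near|]. split; [|auto].
          rewrite Rminus_diag, Rabs_R0. exact Hd. }
    assert (g0 : forall z, 0 <= g z).
    { intro z. unfold g. clear. induction l as [|i l IH]; simpl; [lra|].
      apply Rle_trans with (1 := IH). apply Rmax_l. }
    assert (gle : forall z, g z < e -> U z /\ z <> y).
    { intros z Hz. destruct (Hl z) as [h1 [i h2]].
      - revert Hz. unfold g. clear. induction l as [|j l IH]; simpl; [intros _ i []|].
        intros Hz i [<-|hi].
        + apply Rle_lt_trans with (2 := Hz). apply Rmax_r.
        + apply IH; [|exact hi]. apply Rle_lt_trans with (2 := Hz). apply Rmax_l.
      - split; [exact h1|]. intros ->. lra. }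
    assert (gx : g x = 0).
    { unfold g. clear. induction l as [|i l IH]; simpl; [reflexivity|].
      rewrite IH, Rminus_diag, Rabs_R0. apply Rmax_left. lra. }
    assert (f0 : forall z, ~ g z < e -> Rmax 0 (1 - g z * / e) = 0).
    { intros z Hz. apply Rmax_left.
      assert (1 <= g z * / e); [|lra]. rewrite <- (Rinv_r e) by lra.
      apply Rmult_le_compat_r; [left; apply Rinv_0_lt_compat; exact He|lra]. }
    exists (fun z => Rmax 0 (1 - g z * / e)). split; [|split; [|split; [|split]]].
    + apply (continuous_lipschitz T g (fun r => Rmax 0 (1 - r * / e)) (/ e));
        [left; apply Rinv_0_lt_compat; exact He| |exact gc].
      intros a b. rewrite <- (Rabs_right (/ e)) at 3
        by (left; apply Rinv_0_lt_compat; exact He).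
      rewrite <- Rabs_mult.
      replace (/ e * (a - b)) with (a * / e - b * / e) by ring.
      generalize (a * / e) (b * / e). intros u v.
      unfold Rmax, Rabs. repeat destruct Rle_dec; repeat destruct Rcase_abs; lra.
    + intro z. split; [apply Rmax_l|]. apply Rmax_lub; [lra|].
      assert (0 <= g z * / e); [|lra].
      apply Rmult_le_pos; [apply g0|left; apply Rinv_0_lt_compat; exact He].
    + rewrite gx, Rmult_0_l, Rminus_0_r. apply Rmax_right. lra.
    + apply f0. intro h. exact (proj2 (gle y h) eq_refl).
    + intros z Uz. apply f0. intro h. exact (Uz (proj1 (gle z h))).
Qed.

(** A code is a finite list of constraints: coordinate, number of a rational centre, and [k] for the
    radius [1/(k+1)]. Countably many centres and radii keep the codes over a small set of
    coordinates small. *)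
Definition code := list (I * (nat * nat)).

Definition in_box (s : code) (x : K) : Prop :=
  forall i n k, In (i, (n, k)) s -> Rabs (phi x i - rational n) < / (INR k + 1).

Definition over (A : I -> Prop) (s : code) : Prop := forall p, In p s -> A (fst p).

Lemma in_box_app s t x : in_box (s ++ t) x <-> in_box s x /\ in_box t x.
Proof.
  unfold in_box. split.
  - intros H. split; intros; apply H; apply in_or_app; auto.
  - intros [h1 h2] i n k Hi. apply in_app_or in Hi as [Hi|Hi]; auto.
Qed.

Lemma small_box x i d : 0 < d -> exists n k, in_box ((i, (n, k)) :: nil) x /\
  forall y, in_box ((i, (n, k)) :: nil) y -> Rabs (phi y i - phi x i) < d.
Proof.
  intros Hd. destruct (inv_succ_lt (d / 2)) as [k Hk]; [lra|].
  destruct (rational_dense (phi x i) (/ (INR k + 1)) (inv_succ_pos k)) as [n Hn].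
  exists n, k. split.
  - intros j n' k' [E|[]]. injection E as <- <- <-. exact Hn.
  - intros y Hy. specialize (Hy i n k (or_introl eq_refl)).
    apply Rabs_def2 in Hn, Hy. apply Rabs_def1; lra.
Qed.

Definition coords (U : K -> Prop) (i : I) : Prop := exists x, U x /\ phi x i <> 0.

(** Coordinates that vanish on [O] impose nothing on points of [O], so boxes over the remaining ones
    suffice inside [O]. *)
Lemma box_relative (O V : K -> Prop) x : is_open T V -> V x -> O x ->
  exists s, over (coords O) s /\ in_box s x /\ forall y, O y -> in_box s y -> V y.
Proof.
  intros Vo Vx Ox. destruct (box_nbhd V x Vo Vx) as [l [d [Hd Hl]]].
  assert (H : exists s, over (coords O) s /\ in_box s x /\
    forall y, O y -> in_box s y -> forall i, In i l -> Rabs (phi y i - phi x i) < d).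
  { clear Hl. induction l as [|i l [s [h1 [h2 h3]]]].
    - exists nil. split; [intros p []|]. split; [intros i n k []|]. intros y _ _ i [].
    - destruct (classic (coords O i)) as [Hi|Hi].
      + destruct (small_box x i d Hd) as [n [k [g1 g2]]].
        exists ((i, (n, k)) :: s). split; [|split].
        * intros p [<-|hp]; [exact Hi|auto].
        * apply (in_box_app (_ :: nil)). auto.
        * intros y Oy By. apply (in_box_app (_ :: nil)) in By as [b1 b2].
          intros j [<-|hj]; [auto|eauto].
      + exists s. split; [exact h1|]. split; [exact h2|]. intros y Oy By j [<-|hj]; [|eauto].
        assert (E : forall z, O z -> phi z i = 0).
        { intros z Oz. apply NNPP. intro h. apply Hi. exists z; auto. }
        rewrite !E, Rminus_diag, Rabs_R0 by assumption. exact Hd. }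
  destruct H as [s [h1 [h2 h3]]]. exists s. split; [exact h1|]. split; [exact h2|]. eauto.
Qed.

Lemma small_codes (A : I -> Prop) : small A -> small (over A).
Proof.
  intros HA. apply (small_lists (fun p : I * (nat * nat) => A (fst p))).
  assert (HN : small (fun _ : nat * nat => True)).
  { apply small_countable. exists Cantor.to_nat. intros p q _ _. apply Cantor.to_nat_inj. }
  generalize (small_prod _ _ HA HN). apply small_sub. auto.
Qed.

(** * Coordinate sets to which points of [K] restrict *)

Section Closure.
Context (x0 : K) (A : I -> Prop).

Definition box_point (s : code) : K := epsilon (inhabits x0) (in_box s).

(* Points of [K] chosen in all boxes over the set have their supports in it; by
   compactness this makes restriction to the set map [K] into itself. *)
Inductive closure : I -> Prop :=
| closure_base i : A i -> closure i
| closure_point s i : (forall p, In p s -> closure (fst p)) -> phi (box_point s) i <> 0 -> closure i.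

(** Otherwise compactness leaves finitely many coordinates where every candidate fails. Those in the
    closure fit in a code [s] whose box contains [x]; the point chosen in that box meets these
    constraints, and its support lies in the closure by [closure_point]. *)
Lemma closure_good x :
  exists y, forall i, (closure i -> phi y i = phi x i) /\ (~ closure i -> phi y i = 0).
Proof.
  apply NNPP. intros Hn.
  destruct (Tcomp (fun U => exists i d, 0 < d /\
     ((closure i /\ U = fun y => d < Rabs (phi y i - phi x i)) \/
      (~ closure i /\ U = fun y => d < Rabs (phi y i - 0))))) as [L [HL Lc]].
  - intros U [i [d [_ [[_ ->]|[_ ->]]]]]; apply open_coord_far.
  - intro y. apply NNPP. intros Hc. apply Hn. exists y. intros i. split; intros Ci.
    + apply NNPP. intros h. apply Hc.
      assert (0 < Rabs (phi y i - phi x i)) by (apply Rabs_pos_lt; lra).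
      exists (fun z => Rabs (phi y i - phi x i) / 2 < Rabs (phi z i - phi x i)).
      split; [|lra]. exists i, (Rabs (phi y i - phi x i) / 2). split; [lra|]. auto.
    + apply NNPP. intros h. apply Hc.
      assert (0 < Rabs (phi y i - 0)) by (apply Rabs_pos_lt; lra).
      exists (fun z => Rabs (phi y i - 0) / 2 < Rabs (phi z i - 0)).
      split; [|lra]. exists i, (Rabs (phi y i - 0) / 2). split; [lra|]. auto.
  - assert (H : exists s, over closure s /\ in_box s x /\
      forall y, in_box s y -> (forall i, ~ closure i -> phi y i = 0) -> forall U, In U L -> ~ U y).
    { clear Lc. induction L as [|U L IH].
      - exists nil. split; [intros p []|]. split; [intros i n k []|]. intros y _ _ i [].
      - destruct IH as [s [h1 [h2 h3]]]; [intros U' h; apply HL; right; exact h|].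
        destruct (HL U (or_introl eq_refl)) as [i [d [Hd [[Ci ->]|[Ci ->]]]]].
        + destruct (small_box x i d Hd) as [n [k [g1 g2]]].
          exists ((i, (n, k)) :: s). split; [|split].
          * intros p [<-|hp]; [exact Ci|auto].
          * apply (in_box_app (_ :: nil)). auto.
          * intros y By Hy. apply (in_box_app (_ :: nil)) in By as [b1 b2].
            intros U [<-|hU]; [|apply h3; assumption]. specialize (g2 y b1). lra.
        + exists s. split; [exact h1|]. split; [exact h2|]. intros y By Hy U [<-|hU]; [|apply h3; assumption].
          rewrite (Hy i Ci), Rminus_diag, Rabs_R0. lra. }
    destruct H as [s [h1 [h2 h3]]].
    destruct (Lc (box_point s)) as [U [hU Up]].
    revert Up. apply h3 with (3 := hU).
    + apply (epsilon_spec (inhabits x0) (in_box s)). exists x. exact h2.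
    + intros i Ci. apply NNPP. intro h. apply Ci. apply (closure_point s); auto.
Qed.

Lemma small_closure : small A -> small closure.
Proof.
  intros HA.
  (* Codes are finite, so countably many stages exhaust the closure; each adds countable supports
     indexed by a small set of codes. *)
  set (st := fix st n := match n with
    | O => A
    | S n => fun i => st n i \/ exists s, over (st n) s /\ phi (box_point s) i <> 0 end).
  assert (mono : forall m n i, st n i -> st (m + n)%nat i).
  { induction m as [|m IH]; [auto|]. intros n i h. left. apply IH. exact h. }
  assert (H : forall i, closure i -> exists n, st n i).
    { intros i h. induction h as [i Ai|s i Hs IH Hi]; [exists 0%nat; exact Ai|].
    assert (Q : exists n, over (st n) s).
    { clear Hs Hi. induction s as [|p s IHs]; [exists 0%nat; intros p []|].
      destruct IHs as [n Hn]; [intros q hq; apply IH; right; exact hq|].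
      destruct (IH p (or_introl eq_refl)) as [m Hm].
      exists (m + n)%nat. intros q [<-|hq].
      - rewrite Nat.add_comm. apply mono. exact Hm.
      - apply mono. apply Hn. exact hq. }
    destruct Q as [n Q]. exists (S n). right. exists s. auto. }
  apply (small_sub _ (fun i => exists n, st n i) H). apply small_Union.
  induction n as [|n IH]; [exact HA|].
  apply small_or; [exact IH|].
  apply (small_unions (over (st n)) (fun s i => phi (box_point s) i <> 0)).
  - apply small_codes. exact IH.
  - intro s. apply phi_sigma.
Qed.

End Closure.

Lemma small_coords_Union (S : nat -> K -> Prop) (O : K -> Prop) :
  (forall x, O x -> exists n, S n x) -> (forall n, small (coords (S n))) -> small (coords O).
Proof.
  intros H HS. apply (small_sub _ (fun i => exists n, coords (S n) i)).
  - intros i [x [Ox hx]]. destruct (H x Ox) as [n Sx]. exists n, x. auto.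
  - apply small_Union. exact HS.
Qed.

Lemma small_coords_sub (U V : K -> Prop) :
  (forall x, U x -> V x) -> small (coords V) -> small (coords U).
Proof. intros H. apply small_sub. intros i [x [Ux hx]]. exists x. auto. Qed.

Lemma small_coords_or (U V O : K -> Prop) :
  (forall x, O x -> U x \/ V x) -> small (coords U) -> small (coords V) -> small (coords O).
Proof.
  intros H HU HV. apply (small_sub _ (fun i => coords U i \/ coords V i)).
  - intros i [x [Ox hx]]. destruct (H x Ox); [left|right]; exists x; auto.
  - apply small_or; assumption.
Qed.

Lemma small_coords_pt (U : K -> Prop) :
  (forall x y, U x -> U y -> x = y) -> small (coords U).
Proof.
  intros H. destruct (classic (exists x, U x)) as [[x Ux]|hn].
  - apply (small_sub _ (fun i => phi x i <> 0)).
    + intros i [y [Uy hy]]. rewrite (H x y Ux Uy). exact hy.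
    + apply small_countable. apply phi_sigma.
  - apply small_subsingleton. intros i j [x [Ux _]]. exfalso; eauto.
Qed.

(** Each [f w] contains a nonempty trace on [O] of a box over [coords O]. Disjointness makes the
    codes of these boxes distinct, so [W] embeds in the codes. *)
Lemma big_coords_disjoint (f : W -> K -> Prop) (O : K -> Prop) :
  (forall w, is_open T (f w)) -> (forall w, exists x, f w x) -> (forall w x, f w x -> O x) ->
  (forall w w' x, f w x -> f w' x -> w = w') -> big (coords O).
Proof.
  intros fo fn fO fd. apply NNPP. intros hs. apply (small_codes _ hs).
  assert (H : forall w, exists s, over (coords O) s /\
            (exists x, f w x /\ in_box s x) /\ forall y, O y -> in_box s y -> f w y).
  { intro w. destruct (fn w) as [x hx].
    destruct (box_relative O (f w) x (fo w) hx (fO w x hx)) as [s [h1 [h2 h3]]].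
    exists s. eauto. }
  destruct (choice _ H) as [s Hs]. exists s. split.
  - intros w _. apply Hs.
  - intros w w' _ _ E. destruct (Hs w) as [_ [[x [fx bx]] _]], (Hs w') as [_ [_ h]].
    rewrite E in bx. apply (fd w w' x fx). apply h; eauto.
Qed.

(** * Indivisible large open sets do not exist *)

Section Atom.
Context (U : K -> Prop) (U_open : is_open T U) (U_big : big (coords U)).
Context (U_atom : forall V V', is_open T V -> is_open T V' ->
  (forall x, V x -> U x) -> (forall x, V' x -> U x) -> (forall x, V x -> V' x -> False) ->
  small (coords V) \/ small (coords V')).

(** Of the two sides of any cut [q] one is small. At the supremum [t] of the cuts whose lower side
    is small, both sides are countable unions of small ones. *)
Lemma atom_center i : exists t, small (coords (fun x => U x /\ phi x i <> t)).
Proof.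
  set (lo := fun q x => U x /\ phi x i < q). set (hi := fun q x => U x /\ q < phi x i).
  assert (lo_open : forall q, is_open T (lo q)).
  { intro q. apply open_inter; [exact U_open|apply open_coord_lt]. }
  assert (hi_open : forall q, is_open T (hi q)).
  { intro q. apply open_inter; [exact U_open|apply open_coord_gt]. }
  assert (alt : forall q, small (coords (lo q)) \/ small (coords (hi q))).
  { intro q. apply U_atom; auto; unfold lo, hi; try tauto. intros x [_ h] [_ h']. lra. }
  (* The lower parts, and likewise the upper parts, exhaust [U] along the integers, so they cannot
     all be small; hence the set of cuts defining [t] is bounded above and nonempty. *)
  assert (ex : forall q : R -> K -> Prop, (q = lo \/ q = fun r x => U x /\ - r < phi x i) ->
             exists n, ~ small (coords (q (INR n)))).
  { intros q hq. apply NNPP. intros hn.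
    apply (small_coords_Union (fun n => q (INR n)) U) with (3 := U_big).
    - intros x Ux. destruct (INR_unbounded (Rabs (phi x i))) as [n Hn]. exists n.
      apply Rabs_def2 in Hn. destruct hq as [-> | ->]; unfold lo; split; lra || exact Ux.
    - intro n. apply NNPP. intro h. apply hn. exists n. exact h. }
  destruct (completeness (fun q => small (coords (lo q)))) as [t [t1 t2]].
  - destruct (ex lo (or_introl eq_refl)) as [n hn]. exists (INR n). intros q hq.
    apply Rnot_lt_le. intro h. apply hn. revert hq. apply small_coords_sub.
    intros x [Ux hx]. split; [exact Ux|lra].
  - destruct (ex _ (or_intror eq_refl)) as [n hn]. exists (- INR n).
    destruct (alt (- INR n)) as [h|h]; [exact h|]. exfalso. exact (hn h).
  - exists t.
    apply (small_coords_or (lo t) (hi t)).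
    + intros x [Ux hx]. destruct (Rtotal_order (phi x i) t) as [h|[h|h]]; [left|contradiction|right];
        split; assumption.
    + apply (small_coords_Union (fun n => lo (t - / (INR n + 1)))).
      * intros x [Ux hx]. destruct (inv_succ_lt (t - phi x i)) as [n hn]; [lra|].
        exists n. split; [exact Ux|lra].
      * intro n. apply NNPP. intro h.
        assert (t <= t - / (INR n + 1)); [|generalize (inv_succ_pos n); lra].
        apply t2. intros q hq. apply Rnot_lt_le. intro hl. apply h. revert hq.
        apply small_coords_sub. intros x [Ux hx]. split; [exact Ux|lra].
    + apply (small_coords_Union (fun n => hi (t + / (INR n + 1)))).
      * intros x [Ux hx]. destruct (inv_succ_lt (phi x i - t)) as [n hn]; [lra|].
        exists n. split; [exact Ux|lra].
      * intro n. destruct (alt (t + / (INR n + 1))) as [h|h]; [|exact h].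
        apply t1 in h. generalize (inv_succ_pos n). lra.
Qed.

Definition family_union (F : (K -> Prop) -> Prop) (x : K) : Prop := exists V, F V /\ V x.

(** A maximal disjoint family works: away from the single point with coordinates [t], the set [U] is
    covered by small open sets, so maximality leaves only the countably many coordinates of that
    point to be missed. *)
Lemma atom_small_family : exists F : (K -> Prop) -> Prop,
  (forall V, F V -> is_open T V /\ (forall x, V x -> U x) /\ small (coords V) /\ exists x, V x) /\
  (forall V V' x, F V -> F V' -> V x -> V' x -> V = V') /\
  big (coords (family_union F)).
Proof.
  destruct (choice _ atom_center) as [t Ht].
  set (P := fun F : (K -> Prop) -> Prop =>
    (forall V, F V -> is_open T V /\ (forall x, V x -> U x) /\ small (coords V) /\ exists x, V x) /\
    (forall V V' x, F V -> F V' -> V x -> V' x -> V = V')).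
  destruct (zorn_union P) as [F [[F1 F2] Fmax]].
  { intros C HC Cch. split.
    - intros V [F [CF FV]]. exact (proj1 (HC F CF) V FV).
    - intros V V' x [F [CF FV]] [F' [CF' FV']].
      destruct (Cch F F' CF CF') as [h|h].
      + apply (proj2 (HC F' CF')); auto.
      + apply (proj2 (HC F CF)); auto. }
  exists F. split; [exact F1|]. split; [exact F2|].
  apply NNPP. intros hs. apply (small_sub _
    (fun i => coords (family_union F) i \/ coords (fun x => forall j, phi x j = t j) i)) with (3 := U_big).
  2: { apply small_or; [exact hs|]. apply small_coords_pt. intros x y hx hy. apply phi_inj.
       apply functional_extensionality. intro j. rewrite hx, hy. reflexivity. }
  intros i [x [Ux hx]]. apply NNPP. intros hn. apply not_or_and in hn as [h1 h2].
  assert (Hj : exists j, phi x j <> t j).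
  { apply not_all_ex_not. intros h. apply h2. exists x. auto. }
  destruct Hj as [j Hj].
  (* [N] is small because coordinate [j] avoids its centre, and it is disjoint from the family
     because coordinate [i] vanishes on the latter. *)
  set (N := fun y => (U y /\ phi y j <> t j) /\ phi y i <> 0).
  assert (HN : F N).
  { apply (Fmax (fun V => F V \/ V = N)); auto. split.
    - intros V [FV| ->]; [auto|]. split; [|split; [|split]].
      + apply open_inter; [apply open_inter|]; [exact U_open|apply open_coord_neq|apply open_coord_neq].
      + unfold N; tauto.
      + generalize (Ht j). apply small_coords_sub. unfold N. tauto.
      + exists x. unfold N; auto.
    - assert (dis : forall V y, F V -> V y -> ~ N y).
      { intros V y FV Vy [_ hy]. apply h1. exists y. split; [exists V; auto|exact hy]. }
      intros V V' y [FV| ->] [FV'| ->] Vy Vy'; auto; try (exfalso; eapply dis; eassumption).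
      exact (F2 V V' y FV FV' Vy Vy'). }
  apply h1. exists x. split; [|exact hx]. exists N. split; [exact HN|]. unfold N; auto.
Qed.

(* The small members of the family carry a countably additive two-valued measure
   ("the union of the subfamily is large") vanishing at points, which is
   impossible if the family embeds in [W]; otherwise it contains two disjoint
   copies of [W]. *)
Lemma no_atom : False.
Proof.
  destruct atom_small_family as [F [F1 [F2 Fbig]]].
  set (O := fun G x => exists V, (F V /\ G V) /\ V x).
  assert (Oo : forall G, is_open T (O G)).
  { intro G. apply open_union. intros V [FV _]. apply F1; exact FV. }
  assert (alt : forall G, small (coords (O G)) \/ small (coords (O (fun V => ~ G V)))).
  { intro G. apply U_atom; try apply Oo.
    - intros x [V [[FV _] Vx]]. apply (F1 V FV). exact Vx.
    - intros x [V [[FV _] Vx]]. apply (F1 V FV). exact Vx.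
    - intros x [V [[FV GV] Vx]] [V' [[FV' GV'] Vx']].
      rewrite (F2 V V' x FV FV' Vx Vx') in GV. exact (GV' GV). }
  destruct (embeds_total (fun _ : K => True) (fun _ => 0%Z : Z) F (fun _ : W => True))
    as [[e [_ einj]]|[f [fF finj]]].
  (* [e V k] takes countably many values, so one value carries the whole measure; over all [k] these
     values single out at most one member. *)
  - assert (H : forall k, exists z, small (coords (O (fun V => e V k <> z)))).
    { intro k. apply NNPP. intros hn.
      apply (small_coords_Union (fun n => O (fun V =>
         e V k = Z.of_nat (fst (Cantor.of_nat n)) - Z.of_nat (snd (Cantor.of_nat n)))%Z)
         (family_union F)) with (3 := Fbig).
      - intros x [V [FV Vx]].
        exists (Cantor.to_nat (Z.to_nat (e V k), Z.to_nat (- e V k))).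
        exists V. split; [|exact Vx]. split; [exact FV|].
        rewrite Cantor.cancel_of_to. simpl. lia.
      - intro n. destruct (alt (fun V =>
         e V k = Z.of_nat (fst (Cantor.of_nat n)) - Z.of_nat (snd (Cantor.of_nat n)))%Z) as [h|h];
          [exact h|]. exfalso. apply hn. eexists. exact h. }
    destruct (choice _ H) as [z Hz].
    apply (small_coords_or (fun x => exists k, O (fun V => e V k <> z k) x)
             (O (fun V => e V = z)) (family_union F)) with (4 := Fbig).
    + intros x [V [FV Vx]]. destruct (classic (e V = z)) as [E|E].
      * right. exists V. auto.
      * left. apply NNPP. intros hn. apply E. apply functional_extensionality. intro k.
        apply NNPP. intro h. apply hn. exists k, V. auto.
    + apply (small_coords_Union (fun k => O (fun V => e V k <> z k))); auto.
    + destruct (classic (exists V, F V /\ e V = z)) as [[V [FV E]]|hn].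
      * apply (small_coords_sub _ V); [|apply (F1 V FV)].
        intros x [V' [[FV' E'] Vx]]. rewrite (einj V V') ; congruence.
      * apply small_coords_pt. intros x y [V [[FV E] _]]. exfalso; eauto.
  - set (cons := fun (z : Z) (w : W) => (fun n => match n with O => z | S n => w n end) : W).
    assert (consinj : forall z z' w w', cons z w = cons z' w' -> z = z' /\ w = w').
    { intros z z' w w' E. split.
      - exact (f_equal (fun v : W => v 0%nat) E).
      - apply functional_extensionality. intro n. exact (f_equal (fun v : W => v (S n)) E). }
    assert (B : forall (z : Z) (G : (K -> Prop) -> Prop),
              (forall w, G (f (cons z w))) -> big (coords (O G))).
    { intros z G HG. assert (Ff := fun w => fF (cons z w) Logic.I).
      apply (big_coords_disjoint (fun w => f (cons z w))).
      - intro w. apply F1. apply Ff.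
      - intro w. apply F1. apply Ff.
      - intros w x hx. exists (f (cons z w)). auto.
      - intros w w' x hx hx'. apply (consinj z z). apply finj; try exact Logic.I.
        apply (F2 _ _ x); auto. }
    set (G := fun V => exists w, V = f (cons 0%Z w)).
    destruct (alt G) as [h|h]; apply h.
    + apply (B 0%Z). intro w. exists w. reflexivity.
    + apply (B 1%Z). intros w [w' E]. apply finj in E; try exact Logic.I.
      apply consinj in E. destruct E. discriminate.
Qed.

End Atom.

Lemma big_split U : is_open T U -> big (coords U) -> exists V V',
  (is_open T V /\ big (coords V)) /\ (is_open T V' /\ big (coords V')) /\
  (forall x, V x -> U x) /\ (forall x, V' x -> U x) /\ (forall x, V x -> V' x -> False).
Proof.
  intros Uo Ub. apply NNPP. intros hn. apply (no_atom U Uo Ub).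
  intros V V' Vo Vo' h h' hd. apply NNPP. intros hs. apply not_or_and in hs as [s1 s2].
  apply hn. exists V, V'. repeat split; auto; apply NNPP; assumption.
Qed.

(** One half of each splitting is kept and the other is split again. *)
Lemma disjoint_big_sequence : big (coords (fun _ => True)) ->
  exists U : nat -> K -> Prop, (forall n, is_open T (U n)) /\ (forall n, big (coords (U n))) /\
    forall m n x, U m x -> U n x -> m = n.
Proof.
  intros HK.
  assert (H : forall U, exists p : (K -> Prop) * (K -> Prop), is_open T U /\ big (coords U) ->
    (is_open T (fst p) /\ big (coords (fst p))) /\ (is_open T (snd p) /\ big (coords (snd p))) /\
    (forall x, fst p x -> U x) /\ (forall x, snd p x -> U x) /\ (forall x, fst p x -> snd p x -> False)).
  { intro U. destruct (classic (is_open T U /\ big (coords U))) as [[h1 h2]|h].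
    - destruct (big_split U h1 h2) as [V [V' h]]. exists (V, V'). auto.
    - exists (U, U). tauto. }
  destruct (choice _ H) as [sp Hsp].
  set (r := fix r n := match n with O => (fun _ => True) | S n => snd (sp (r n)) end).
  assert (Hr : forall n, is_open T (r n) /\ big (coords (r n))).
  { induction n as [|n IH]; [split; [apply open_full|exact HK]|]. apply (Hsp (r n) IH). }
  assert (dec : forall k n x, r (k + n)%nat x -> r n x).
  { induction k as [|k IH]; [auto|]. intros n x h. apply IH. apply (Hsp _ (Hr (k + n)%nat)). exact h. }
  assert (lt_dis : forall m n x, (m < n)%nat -> fst (sp (r m)) x -> fst (sp (r n)) x -> False).
  { intros m n x hmn h h'. destruct (Hsp _ (Hr m)) as [_ [_ [_ [_ hd]]]]. apply (hd x h).
    apply (dec (n - S m)%nat (S m) x). replace (n - S m + S m)%nat with n by lia.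
    destruct (Hsp _ (Hr n)) as [_ [_ [h3 _]]]. exact (h3 x h'). }
  exists (fun n => fst (sp (r n))). split; [|split].
  - intro n. apply (Hsp _ (Hr n)).
  - intro n. apply (Hsp _ (Hr n)).
  - intros m n x h h'. destruct (Nat.lt_trichotomy m n) as [c|[c|c]]; [|exact c|]; exfalso; eauto.
Qed.

(** [y b] is the restriction of [x b] to the closure of the supports of the earlier points. The pair
    therefore differs only in the support of [x b] outside that closure, whereas every later closure
    contains this support. *)
Lemma disjoint_differences (U : W -> K -> Prop) :
  (forall b, big (coords (U b))) ->
  exists x y : W -> K, (forall b, U b (x b) /\ x b <> y b) /\
    forall b b' i, b <> b' -> phi (x b) i <> phi (y b) i -> phi (x b') i = phi (y b') i.
Proof.
  intros HU.
  assert (x0 : K).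
  { destruct (constructive_indefinite_description _ (HU (fun _ => 0%Z))) as [f [Hf _]].
    destruct (constructive_indefinite_description _ (Hf (fun _ => 0%Z) Logic.I)) as [x _]. exact x. }
  destruct small_initial_segments as [lt [wf [tot seg]]].
  set (base := fun b (x : forall a, lt a b -> K) i => exists a (h : lt a b), phi (x a h) i <> 0).
  set (step := fun b (x : forall a, lt a b -> K) => epsilon (inhabits x0)
     (fun z => U b z /\ exists i, phi z i <> 0 /\ ~ closure x0 (base b x) i)).
  set (x := Fix wf (fun _ => K) step).
  set (A := fun b i => exists a, lt a b /\ phi (x a) i <> 0).
  assert (Ex : forall b, x b = epsilon (inhabits x0)
     (fun z => U b z /\ exists i, phi z i <> 0 /\ ~ closure x0 (A b) i)).
  { intro b. unfold x at 1. rewrite Fix_eq.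
    - change (step b (fun a _ => x a) =
        epsilon (inhabits x0) (fun z => U b z /\ exists i, phi z i <> 0 /\ ~ closure x0 (A b) i)).
      unfold step. replace (base b (fun a _ => x a)) with (A b); [reflexivity|].
      apply pred_ext. intro i. unfold A, base. split; [intros [a [h1 h2]]|intros [a [h1 h2]]]; eauto.
    - intros c f g E. replace g with f; [reflexivity|].
      apply functional_extensionality_dep. intro a. apply functional_extensionality_dep. auto. }
  (* A suitable point exists, since a large set of coordinates is not contained in a small
     closure. *)
  assert (Hx : forall b, U b (x b) /\ exists i, phi (x b) i <> 0 /\ ~ closure x0 (A b) i).
  { intro b. rewrite Ex. apply epsilon_spec. apply NNPP. intros hn.
    apply (small_sub (coords (U b)) (closure x0 (A b))) with (3 := HU b).
    - intros i [z [Uz hz]]. apply NNPP. intro h. apply hn. exists z. eauto.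
    - apply small_closure. apply (small_unions (fun a => lt a b) (fun a i => phi (x a) i <> 0)).
      + apply seg.
      + intro a. apply phi_sigma. }
  destruct (choice _ (fun b => closure_good x0 (A b) (x b))) as [y Hy].
  assert (D : forall b i, phi (x b) i <> phi (y b) i -> phi (x b) i <> 0 /\ ~ closure x0 (A b) i).
  { intros b i h. destruct (classic (closure x0 (A b) i)) as [c|c].
    - exfalso. apply h. symmetry. apply (Hy b i). exact c.
    - split; [|exact c]. intro h0. apply h. rewrite h0. symmetry. apply (Hy b i). exact c. }
  exists x, y. split.
  - intro b. destruct (Hx b) as [h1 [i [h2 h3]]]. split; [exact h1|].
    intros E. apply h2. rewrite E. apply (Hy b i). exact h3.
  - assert (L : forall a b i, lt a b -> phi (x a) i <> phi (y a) i -> phi (x b) i <> phi (y b) i -> False).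
    { intros a b i hab ha hb. apply D in ha, hb. apply (proj2 hb). apply closure_base.
      exists a. tauto. }
    intros b b' i hne h. apply NNPP. intro h'.
    destruct (tot b b') as [c|[c|c]]; [|contradiction|]; eapply L; eassumption.
Qed.

Lemma bump_system (idx : W -> nat) : big (coords (fun _ => True)) ->
  exists (U : nat -> K -> Prop) (x y : W -> K) (f : W -> K -> R),
    (forall m n z, U m z -> U n z -> m = n) /\
    (forall b, continuous_real T (f b) /\ (forall z, 0 <= f b z <= 1) /\
       f b (x b) = 1 /\ f b (y b) = 0 /\ forall z, ~ U (idx b) z -> f b z = 0) /\
    (forall g e, continuous_real T g -> 0 < e ->
       exists l : list W, forall b, ~ In b l -> Rabs (g (x b) - g (y b)) < e).
Proof.
  intros HK. destruct (disjoint_big_sequence HK) as [U [Uo [Ub Ud]]].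
  destruct (disjoint_differences (fun b => U (idx b)) (fun b => Ub (idx b))) as [x [y [Hxy Hd]]].
  assert (H : forall b, exists f, continuous_real T f /\ (forall z, 0 <= f z <= 1) /\
       f (x b) = 1 /\ f (y b) = 0 /\ forall z, ~ U (idx b) z -> f z = 0).
  { intro b. apply urysohn; [apply Uo|apply Hxy|apply Hxy]. }
  destruct (choice _ H) as [f Hf].
  exists U, x, y, f. split; [exact Ud|]. split; [exact Hf|].
  intros g e gc He. destruct (finite_dependence g e gc He) as [l Hl].
  (* Each coordinate distinguishes at most one of the pairs. *)
  assert (Hl2 : exists l2 : list W, forall b i, In i l -> phi (x b) i <> phi (y b) i -> In b l2).
  { clear Hl. induction l as [|i l [l2 IH]]; [exists nil; intros b i []|].
    destruct (classic (exists b, phi (x b) i <> phi (y b) i)) as [[b hb]|hn].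
    - exists (b :: l2). intros b' j [<-|hj] h; [left|right; eauto].
      apply NNPP. intro hne. apply h. apply (Hd b b' i); auto.
    - exists l2. intros b j [<-|hj] h; [exfalso|]; eauto. }
  destruct Hl2 as [l2 Hl2]. exists l2. intros b hb. apply Hl. intros i hi.
  apply NNPP. intro h. apply hb. eauto.
Qed.

End Corson.

(** * Banach spaces of bounded functions *)

Definition uniform_limit {Y : Type} (u : nat -> Y -> R) (l : Y -> R) : Prop :=
  forall e, 0 < e -> exists N, forall n y, (N <= n)%nat -> Rabs (u n y - l y) <= e.

Definition bounded {Y : Type} (f : Y -> R) : Prop := exists M, forall y, Rabs (f y) <= M.

(** One interface for [C(K)], for the pullback and for a complement of [c0] in it. *)
Record function_space {Y : Type} (P : (Y -> R) -> Prop) : Prop := {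
  fs_zero : P (fun _ => 0);
  fs_add : forall f g, P f -> P g -> P (fun y => f y + g y);
  fs_scal : forall a f, P f -> P (fun y => a * f y);
  fs_bounded : forall f, P f -> bounded f;
  fs_limit : forall u l, (forall n, P (u n)) -> uniform_limit u l -> P l }.

Lemma fs_sub {Y : Type} (P : (Y -> R) -> Prop) f g :
  function_space P -> P f -> P g -> P (fun y => f y - g y).
Proof.
  intros HP Pf Pg. replace (fun y => f y - g y) with (fun y => f y + (-1) * g y).
  - apply (fs_add P HP); [exact Pf|apply (fs_scal P HP); exact Pg].
  - apply functional_extensionality. intro y. ring.
Qed.

Lemma uniform_cauchy {Y : Type} (u : nat -> Y -> R) :
  (forall e, 0 < e -> exists N, forall m n y, (N <= m)%nat -> (N <= n)%nat ->
     Rabs (u m y - u n y) <= e) ->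
  exists l, uniform_limit u l.
Proof.
  intros H.
  assert (Hl : forall y, exists l, Un_cv (fun n => u n y) l).
  { intro y. destruct (R_complete (fun n => u n y)) as [l Hl]; [|eauto].
    intros e He. destruct (H (e / 2)) as [N HN]; [lra|]. exists N. intros m n hm hn.
    specialize (HN m n y hm hn). unfold Rdist. lra. }
  destruct (choice _ Hl) as [l L]. exists l. intros e He.
  destruct (H (e / 2)) as [N HN]; [lra|]. exists N. intros n y hn.
  destruct (L y (e / 2)) as [N' HN']; [lra|].
  specialize (HN' (max N N') ltac:(lia)). specialize (HN n (max N N') y hn ltac:(lia)).
  unfold Rdist in HN'. apply Rabs_def2 in HN'. apply Rabs_le.
  revert HN. unfold Rabs. destruct Rcase_abs; lra.
Qed.

(** The value 0 is included so that the set is nonempty even when [Y] is empty. *)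
Definition sup_norm {Y : Type} (f : Y -> R) : R :=
  epsilon (inhabits 0) (is_lub (fun r => r = 0 \/ exists y, r = Rabs (f y))).

Lemma sup_norm_lub {Y : Type} (f : Y -> R) : bounded f ->
  is_lub (fun r => r = 0 \/ exists y, r = Rabs (f y)) (sup_norm f).
Proof.
  intros [M HM]. unfold sup_norm. apply epsilon_spec.
  destruct (completeness (fun r => r = 0 \/ exists y, r = Rabs (f y))) as [m Hm]; [| |eauto].
  - exists (Rmax 0 M). intros r [->|[y ->]]; [apply Rmax_l|].
    apply Rle_trans with (1 := HM y). apply Rmax_r.
  - exists 0. auto.
Qed.

Lemma sup_norm_ge {Y : Type} (f : Y -> R) y : bounded f -> Rabs (f y) <= sup_norm f.
Proof. intros H. apply (sup_norm_lub f H). eauto. Qed.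

Lemma sup_norm_pos {Y : Type} (f : Y -> R) : bounded f -> 0 <= sup_norm f.
Proof. intros H. apply (sup_norm_lub f H). auto. Qed.

Lemma sup_norm_le {Y : Type} (f : Y -> R) r :
  bounded f -> 0 <= r -> (forall y, Rabs (f y) <= r) -> sup_norm f <= r.
Proof. intros H Hr Hf. apply (sup_norm_lub f H). intros s [->|[y ->]]; auto. Qed.

Section FunctionBanach.
Context {Y : Type} (P : (Y -> R) -> Prop) (HP : function_space P).

Let car := { f : Y -> R | P f }.

Lemma fs_ext (z w : car) : (forall y, proj1_sig z y = proj1_sig w y) -> z = w.
Proof.
  destruct z as [f Pf], w as [g Pg]. simpl. intros H.
  assert (f = g) by (apply functional_extensionality; exact H). subst g.
  f_equal. apply proof_irrelevance.
Qed.

Let zero : car := exist _ _ (fs_zero P HP).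
Let add (z w : car) : car := exist _ _ (fs_add P HP _ _ (proj2_sig z) (proj2_sig w)).
Let scal (a : R) (z : car) : car := exist _ _ (fs_scal P HP a _ (proj2_sig z)).
Let norm (z : car) : R := sup_norm (proj1_sig z).

Let bdd (z : car) : bounded (proj1_sig z).
Proof. exact (fs_bounded P HP _ (proj2_sig z)). Qed.

Lemma norm_eq0 (z : car) : norm z = 0 -> z = zero.
Proof.
  intros H. apply fs_ext. intro y. simpl.
  generalize (sup_norm_ge _ y (bdd z)). fold (norm z). rewrite H.
  unfold Rabs. destruct Rcase_abs; lra.
Qed.

Lemma norm_scal_le a (z : car) : norm (scal a z) <= Rabs a * norm z.
Proof.
  apply sup_norm_le.
  - apply bdd.
  - apply Rmult_le_pos; [apply Rabs_pos|apply sup_norm_pos, bdd].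
  - intro y. simpl. rewrite Rabs_mult. apply Rmult_le_compat_l; [apply Rabs_pos|].
    apply sup_norm_ge, bdd.
Qed.

Lemma norm_scal a (z : car) : norm (scal a z) = Rabs a * norm z.
Proof.
  apply Rle_antisym; [apply norm_scal_le|].
  destruct (Req_dec a 0) as [->|Ha].
  - rewrite Rabs_R0, Rmult_0_l. apply sup_norm_pos, bdd.
  - assert (Hp : 0 < Rabs a) by (apply Rabs_pos_lt; exact Ha).
    apply Rmult_le_reg_l with (/ Rabs a); [apply Rinv_0_lt_compat; exact Hp|].
    rewrite <- Rmult_assoc, Rinv_l, Rmult_1_l by lra.
    rewrite <- Rabs_inv. apply Rle_trans with (2 := norm_scal_le (/ a) (scal a z)).
    right. f_equal. apply fs_ext. intro y. simpl. field. exact Ha.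
Qed.

Lemma norm_triangle (z w : car) : norm (add z w) <= norm z + norm w.
Proof.
  apply sup_norm_le.
  - apply bdd.
  - apply Rplus_le_le_0_compat; apply sup_norm_pos, bdd.
  - intro y. simpl. apply Rle_trans with (1 := Rabs_triang _ _).
    apply Rplus_le_compat; apply sup_norm_ge, bdd.
Qed.

Lemma norm_complete (u : nat -> car) :
  (forall eps, 0 < eps -> exists N, forall m n, (N <= m)%nat -> (N <= n)%nat ->
        norm (add (u m) (scal (-1) (u n))) < eps) ->
    exists l, forall eps, 0 < eps -> exists N, forall n, (N <= n)%nat ->
        norm (add (u n) (scal (-1) l)) < eps.
Proof.
  intros H. destruct (uniform_cauchy (fun n => proj1_sig (u n))) as [l Hl].
  - intros e He. destruct (H e He) as [N HN]. exists N. intros m n y hm hn.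
    left. apply Rle_lt_trans with (2 := HN m n hm hn).
    replace (proj1_sig (u m) y - proj1_sig (u n) y)
      with (proj1_sig (add (u m) (scal (-1) (u n))) y) by (simpl; ring).
    apply sup_norm_ge, bdd.
  - exists (exist _ l (fs_limit P HP _ _ (fun n => proj2_sig (u n)) Hl)).
    intros e He. destruct (Hl (e / 2)) as [N HN]; [lra|]. exists N. intros n hn.
    apply Rle_lt_trans with (e / 2); [|lra]. apply sup_norm_le; [apply bdd|lra|].
    intro y. simpl. replace (proj1_sig (u n) y + -1 * l y) with (proj1_sig (u n) y - l y) by ring.
    apply HN. exact hn.
Qed.

Definition function_banach : Banach.
Proof.
  refine (mkBanach car zero add (scal (-1)) scal norm _ _ _ _ _ _ _ _ norm_eq0 norm_scal
            norm_triangle norm_complete); intros; apply fs_ext; intro; simpl; ring.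
Defined.

End FunctionBanach.

(** * The open mapping theorem for restriction operators *)

Section OpenMapping.
Context {X Y : Type} (j : X -> Y) (N : (Y -> R) -> Prop) (E : (X -> R) -> Prop).
Context (HN : function_space N) (HE : function_space E).
Context (restr : forall w, N w -> E (fun x => w (j x))).
Context (onto : forall f, E f -> exists w, N w /\ forall x, w (j x) = f x).

Let near (f g : X -> R) (r : R) : Prop := forall x, Rabs (f x - g x) <= r.
Let lifted (m : R) (g : X -> R) : Prop :=
  exists w, N w /\ (forall x, w (j x) = g x) /\ forall y, Rabs (w y) <= m.

Let near_trans f g h r s : near f g r -> near g h s -> near f h (r + s).
Proof.
  intros h1 h2 x. replace (f x - h x) with ((f x - g x) + (g x - h x)) by ring.
  apply Rle_trans with (1 := Rabs_triang _ _). apply Rplus_le_compat; auto.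
Qed.

Let near_sym f g r : near f g r -> near g f r.
Proof. intros h x. rewrite Rabs_minus_sym. apply h. Qed.

Lemma pow_half_small (C e : R) : 0 < e -> exists n, C * (/ 2) ^ n <= e.
Proof.
  intros He. destruct (pow_lt_1_zero (/ 2) ltac:(rewrite Rabs_right; lra) (e / (Rabs C + 1))) as [n Hn].
  { apply Rdiv_lt_0_compat; [exact He|]. generalize (Rabs_pos C). lra. }
  exists n. specialize (Hn n ltac:(lia)).
  assert (0 < (/ 2) ^ n) by (apply pow_lt; lra).
  rewrite Rabs_right in Hn by lra.
  apply Rle_trans with ((Rabs C + 1) * (/ 2) ^ n).
  - apply Rmult_le_compat_r; [lra|]. generalize (Rle_abs C). lra.
  - replace e with ((Rabs C + 1) * (e / (Rabs C + 1))).
    + apply Rmult_le_compat_l; [generalize (Rabs_pos C)|]; lra.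
    + field. generalize (Rabs_pos C). lra.
Qed.

(** The functions with a lift bounded by some integer exhaust [E], so one of these sets is dense in
    a ball; otherwise shrinking balls that avoid them in turn would have a limit in [E] without a
    bounded lift. *)
Lemma baire_lifted : exists (m : R) f0 r, E f0 /\ 0 < r /\ forall f e, E f -> near f f0 r -> 0 < e ->
  exists g, lifted m g /\ near f g e.
Proof.
  apply NNPP. intros Hn.
  set (good := fun p : (X -> R) * R => E (fst p) /\ 0 < snd p).
  assert (H : forall s : nat * ((X -> R) * R), exists q, good (snd s) -> good q /\
    near (fst q) (fst (snd s)) (snd (snd s) / 2) /\ snd q <= snd (snd s) / 2 /\
    forall g, lifted (INR (fst s)) g -> ~ near (fst q) g (snd q)).
  { intros [m [f0 r]]. simpl. destruct (classic (good (f0, r))) as [[Ef r0]|h].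
    - simpl in Ef, r0. apply NNPP. intros hq. apply Hn. exists (INR m), f0, (r / 2).
      split; [exact Ef|]. split; [lra|]. intros f e Ef' hf He. apply NNPP. intros hg.
      apply hq. exists (f, Rmin e (r / 2)). intros _. simpl.
      split; [split; [exact Ef'|apply Rmin_glb_lt; lra]|]. split; [exact hf|].
      split; [apply Rmin_r|]. intros g hl hng. apply hg. exists g. split; [exact hl|].
      intro x. apply Rle_trans with (1 := hng x). apply Rmin_l.
    - exists (f0, r). intro. contradiction. }
  destruct (choice _ H) as [st Hst].
  set (p := fix p n := match n with O => ((fun _ => 0), 1) | S n => st (n, p n) end).
  assert (pg : forall n, good (p n)).
  { induction n as [|n IH]; [split; simpl; [apply (fs_zero E HE)|lra]|]. apply (Hst (n, p n) IH). }
  assert (ps := fun n => Hst (n, p n) (pg n)). simpl in ps.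
  assert (rn : forall n, snd (p n) <= 1 * (/ 2) ^ n).
  { induction n as [|n IH]; [simpl; lra|].
    destruct (ps n) as [_ [_ [h _]]]. simpl in *. lra. }
  assert (nn : forall k n, near (fst (p (k + n)%nat)) (fst (p n)) (snd (p n) - snd (p (k + n)%nat))).
  { induction k as [|k IH]; intro n.
    - intro x. simpl. rewrite Rminus_diag, Rabs_R0. lra.
    - destruct (ps (k + n)%nat) as [_ [h1 [h2 _]]].
      change (S k + n)%nat with (S (k + n)).
      intro x. apply Rle_trans with (1 := near_trans _ _ _ _ _ h1 (IH n) x). simpl in *. lra. }
  assert (nn2 : forall m n, (n <= m)%nat -> near (fst (p m)) (fst (p n)) (snd (p n))).
  { intros m n h x. replace m with ((m - n) + n)%nat by lia.
    apply Rle_trans with (1 := nn (m - n)%nat n x).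
    generalize (proj2 (pg ((m - n) + n)%nat)). lra. }
  destruct (uniform_cauchy (fun n => fst (p n))) as [f Hf].
  { intros e He. destruct (pow_half_small 2 e He) as [n hn]. exists n. intros a b x ha hb.
    apply Rle_trans with (1 := near_trans _ _ _ _ _ (nn2 a n ha) (near_sym _ _ _ (nn2 b n hb)) x).
    specialize (rn n). lra. }
  assert (fn : forall n, near (fst (p n)) f (snd (p n))).
  { intros n x. apply le_epsilon. intros e He. destruct (Hf e He) as [M HM].
    specialize (HM (max M n) x (Nat.le_max_l _ _)).
    generalize (near_sym _ _ _ (nn2 (max M n) n ltac:(lia)) x). intros h.
    replace (fst (p n) x - f x) with
      ((fst (p n) x - fst (p (max M n)) x) + (fst (p (max M n)) x - f x)) by ring.
    apply Rle_trans with (1 := Rabs_triang _ _). apply Rplus_le_compat; assumption. }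
  assert (Ef : E f).
  { apply (fs_limit E HE (fun n => fst (p n))); [|exact Hf]. intro n. apply (pg n). }
  destruct (onto f Ef) as [w [Nw hw]]. destruct (fs_bounded N HN w Nw) as [M HM].
  destruct (INR_unbounded M) as [m hm].
  destruct (ps m) as [_ [_ [_ h]]]. apply (h f); [|apply (fn (S m))].
  exists w. split; [exact Nw|]. split; [exact hw|]. intro y. specialize (HM y). lra.
Qed.

(** Successive approximation: each step lifts the remainder up to half of its bound, and the lifts
    form a geometric series. *)
Lemma bounded_lift : exists C, forall f, E f -> (forall x, Rabs (f x) <= 1) -> lifted C f.
Proof.
  destruct baire_lifted as [m [f0 [r [Ef0 [Hr H]]]]].
  assert (A : forall f e, E f -> (forall x, Rabs (f x) <= r) -> 0 < e ->
             exists g, lifted (2 * m) g /\ near f g e).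
  { intros f e Ef hf He.
    (* Writing [f] as [(f0 + f) - f0] moves the ball to the origin and doubles the bound. *)
    destruct (H (fun x => f0 x + f x) (e / 2)) as [g1 [[w1 [N1 [e1 b1]]] h1]].
    { apply (fs_add E HE); assumption. }
    { intro x. replace (f0 x + f x - f0 x) with (f x) by ring. apply hf. }
    { lra. }
    destruct (H f0 (e / 2)) as [g2 [[w2 [N2 [e2 b2]]] h2]]; [exact Ef0| |lra|].
    { intro x. rewrite Rminus_diag, Rabs_R0. lra. }
    exists (fun x => g1 x - g2 x). split.
    - exists (fun y => w1 y - w2 y). split; [apply fs_sub; assumption|].
      split; [intro x; rewrite e1, e2; reflexivity|]. intro y.
      generalize (b1 y) (b2 y). unfold Rabs. repeat destruct Rcase_abs; lra.
    - intro x. generalize (h1 x) (h2 x). unfold Rabs. repeat destruct Rcase_abs; lra. }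
  set (M := Rabs (2 * m)).
  set (c := fun n => (/ 2) ^ n).
  assert (c0 : forall n, 0 < c n) by (intro n; apply pow_lt; lra).
  assert (cmono : forall k n, c (k + n)%nat <= c n).
  { induction k as [|k IH]; intro n; [apply Rle_refl|].
    apply Rle_trans with (2 := IH n). unfold c. simpl. generalize (c0 (k + n)%nat). unfold c. lra. }
  assert (B : forall s : nat * (X -> R), exists w,
     E (snd s) /\ (forall x, Rabs (snd s x) <= r * c (fst s)) ->
     N w /\ (forall y, Rabs (w y) <= M * c (fst s)) /\
     forall x, Rabs (snd s x - w (j x)) <= r * c (S (fst s))).
  { intros [n f]. simpl. destruct (classic (E f /\ forall x, Rabs (f x) <= r * c n)) as [[Ef hf]|hn];
      [|exists (fun _ => 0); tauto].
    destruct (A (fun x => / c n * f x) (r / 2)) as [g [[w [Nw [ew bw]]] hg]].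
    - apply (fs_scal E HE). exact Ef.
    - intro x. rewrite Rabs_mult, Rabs_right by (left; apply Rinv_0_lt_compat, c0).
      apply Rmult_le_reg_l with (c n); [apply c0|].
      rewrite <- Rmult_assoc, Rinv_r, Rmult_1_l, Rmult_comm by (generalize (c0 n); lra).
      specialize (hf x). lra.
    - lra.
    - exists (fun y => c n * w y). intros _. split; [apply (fs_scal N HN); exact Nw|]. split.
      + intro y. rewrite Rabs_mult, Rabs_right by (left; apply c0). rewrite Rmult_comm.
        apply Rmult_le_compat_r; [left; apply c0|].
        apply Rle_trans with (1 := bw y). apply Rle_abs.
      + intro x. rewrite ew. specialize (hg x).
        replace (f x - c n * g x) with (c n * (/ c n * f x - g x))
          by (field; generalize (c0 n); lra).
        rewrite Rabs_mult, Rabs_right by (left; apply c0).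
        replace (r * c (S n)) with (c n * (r / 2)) by (unfold c; simpl; field).
        apply Rmult_le_compat_l; [left; apply c0|exact hg]. }
  destruct (choice _ B) as [st Hst].
  (* The [n]-th correction is at most [M / 2^n], hence [2 * M] in total; the factor [/ r] undoes the
     scaling of the unit ball to radius [r]. *)
  exists (/ r * (2 * M)). intros f1 Ef1 hf1.
  set (f := fun x => r * f1 x).
  set (rem := fix rem n := match n with
     | O => f | S n => fun x => rem n x - st (n, rem n) (j x) end).
  assert (R1 : forall n, E (rem n) /\ forall x, Rabs (rem n x) <= r * c n).
  { induction n as [|n IH].
    - split; [apply (fs_scal E HE); exact Ef1|]. intro x. simpl. unfold f, c. simpl.
      rewrite Rabs_mult, Rabs_right by lra. apply Rmult_le_compat_l; [lra|apply hf1].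
    - destruct (Hst (n, rem n) IH) as [h1 [h2 h3]]. split; [|exact h3].
      simpl. apply fs_sub; [exact HE|apply IH|]. apply restr. exact h1. }
  assert (Hs := fun n => Hst (n, rem n) (R1 n)). simpl in Hs.
  set (s := fix s n := match n with O => (fun _ => 0) | S n => fun y => s n y + st (n, rem n) y end).
  assert (sN : forall n, N (s n)).
  { induction n as [|n IH]; [apply (fs_zero N HN)|]. apply (fs_add N HN); [exact IH|apply (Hs n)]. }
  assert (sr : forall n x, s n (j x) = f x - rem n x).
  { induction n as [|n IH]; intro x; simpl; [ring|]. rewrite IH. ring. }
  assert (sc : forall k n y, Rabs (s (k + n)%nat y - s n y) <= 2 * M * (c n - c (k + n)%nat)).
  { induction k as [|k IH]; intros n y.
    - simpl. rewrite Rminus_diag, Rabs_R0. lra.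
    - destruct (Hs (k + n)%nat) as [_ [h _]]. specialize (h y). specialize (IH n y).
      change (S k + n)%nat with (S (k + n)).
      change (s (S (k + n)) y) with (s (k + n)%nat y + st ((k + n)%nat, rem (k + n)%nat) y).
      replace (c (S (k + n))) with (c (k + n)%nat / 2) by (unfold c; simpl; field).
      replace (2 * M * (c n - c (k + n)%nat / 2))
        with (2 * M * (c n - c (k + n)%nat) + M * c (k + n)%nat) by field.
      revert h IH. generalize (2 * M * (c n - c (k + n)%nat)) (M * c (k + n)%nat).
      intros u v. unfold Rabs. repeat destruct Rcase_abs; lra. }
  assert (M0 : 0 <= M) by apply Rabs_pos.
  destruct (uniform_cauchy s) as [w Hw].
  { intros e He. destruct (pow_half_small (4 * M) e He) as [n hn]. exists n. intros a b y ha hb.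
    assert (Q : forall a, (n <= a)%nat -> Rabs (s a y - s n y) <= 2 * M * c n).
    { intros a' ha'. replace a' with ((a' - n) + n)%nat by lia.
      apply Rle_trans with (1 := sc _ _ _). apply Rmult_le_compat_l; [lra|].
      generalize (c0 (a' - n + n)%nat). lra. }
    generalize (Q a ha) (Q b hb). fold (c n) in hn. unfold Rabs. repeat destruct Rcase_abs; lra. }
  assert (Nw : N w) by (apply (fs_limit N HN s); assumption).
  exists (fun y => / r * w y). split; [apply (fs_scal N HN); exact Nw|]. split.
  - intro x. assert (w (j x) = f x); [|rewrite H0; unfold f; field; lra].
    apply cond_eq. intros e He. destruct (Hw (e / 4)) as [n1 h1]; [lra|].
    destruct (pow_half_small r (e / 4)) as [n2 h2]; [lra|].
    specialize (h1 (max n1 n2) (j x) ltac:(lia)). rewrite sr in h1.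
    assert (Rabs (rem (max n1 n2) x) <= e / 4).
    { apply Rle_trans with (2 := h2). apply Rle_trans with (1 := proj2 (R1 _) x).
      apply Rmult_le_compat_l; [lra|].
      replace (max n1 n2) with ((max n1 n2 - n2) + n2)%nat by lia. apply cmono. }
    revert H0 h1. unfold Rabs. repeat destruct Rcase_abs; lra.
  - intro y. rewrite Rabs_mult, Rabs_right by (left; apply Rinv_0_lt_compat; exact Hr).
    apply Rmult_le_compat_l; [left; apply Rinv_0_lt_compat; exact Hr|].
    apply le_epsilon. intros e He. destruct (Hw e He) as [n hn]. specialize (hn n y (le_n n)).
    generalize (sc n 0%nat y). rewrite Nat.add_0_r.
    assert (2 * M * (c 0%nat - c n) <= 2 * M).
    { rewrite <- (Rmult_1_r (2 * M)) at 2. apply Rmult_le_compat_l; [lra|].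
      unfold c at 1. simpl. generalize (c0 n). lra. }
    change (s 0%nat y) with 0. revert hn. unfold Rabs. repeat destruct Rcase_abs; lra.
Qed.

End OpenMapping.

(** * The pullback space *)

(** Numbers the finite sequence of the first [k] terms of [b], each integer being given by its
    positive and negative parts. The successor separates longer sequences from the root and forces
    [k <= node b k]. *)
Fixpoint node (b : W) (k : nat) : nat :=
  match k with
  | O => O
  | S k => S (Cantor.to_nat (node b k, Cantor.to_nat (Z.to_nat (b k), Z.to_nat (- b k))))
  end.

Lemma node_ge b k : (k <= node b k)%nat.
Proof.
  induction k as [|k IH]; [simpl; lia|]. simpl.
  generalize (Cantor.to_nat_non_decreasing (node b k)
    (Cantor.to_nat (Z.to_nat (b k), Z.to_nat (- b k)))). lia.
Qed.

Lemma node_inj b b' k k' : node b k = node b' k' -> k = k' /\ agree k b b'.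
Proof.
  revert k'. induction k as [|k IH]; intros [|k'] E; simpl in E; try discriminate.
  - split; [reflexivity|]. intros i Hi. lia.
  - injection E as E. apply Cantor.to_nat_inj in E. injection E as E1 E2.
    apply Cantor.to_nat_inj in E2. injection E2 as E2 E3.
    apply IH in E1 as [-> H]. split; [reflexivity|].
    intros i Hi. destruct (Nat.eq_dec i k') as [->|h]; [lia|apply H; lia].
Qed.

Lemma node_agree b b' k : agree k b b' -> node b k = node b' k.
Proof.
  induction k as [|k IH]; intros H; [reflexivity|]. simpl.
  rewrite IH, (H k); [reflexivity|lia|]. intros i Hi. apply H. lia.
Qed.

Definition through (b : W) (n : nat) : Prop := exists k, n = node b k.

Lemma through_separated (b : W) (l : list W) :
  exists N, forall k b', (N <= k)%nat -> In b' l -> through b' (node b k) -> b' = b.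
Proof.
  induction l as [|a l [N IH]]; [exists 0%nat; intros k b' _ []|].
  destruct (classic (a = b)) as [->|h].
  - exists N. intros k b' hk [<-|hl] ht; eauto.
  - assert (H : exists i, a i <> b i).
    { apply not_all_ex_not. intro H. apply h. apply functional_extensionality. exact H. }
    destruct H as [i Hi]. exists (max N (S i)). intros k b' hk [<-|hl] [k' ht].
    + exfalso. destruct (node_inj _ _ _ _ ht) as [_ hag]. apply Hi. symmetry. apply hag. lia.
    + apply (IH k); [lia|exact hl|]. exists k'. exact ht.
Qed.

Lemma list_argmax {A : Type} (g : A -> R) (Q : A -> Prop) (l : list A) :
  (exists a, In a l /\ Q a) ->
  exists a, Q a /\ In a l /\ forall a', In a' l -> Q a' -> g a' <= g a.
Proof.
  induction l as [|x l IH]; [intros [a [[] _]]|]. intros H0.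
  destruct (classic (exists a, In a l /\ Q a)) as [h|h].
  - destruct (IH h) as [a [Qa [ha Ha]]].
    destruct (classic (Q x /\ g a <= g x)) as [[Qx hx]|hx].
    + exists x. split; [exact Qx|]. split; [left; reflexivity|].
      intros a' [<-|ha'] Qa'; [lra|]. specialize (Ha a' ha' Qa'). lra.
    + exists a. split; [exact Qa|]. split; [right; exact ha|].
      intros a' [<-|ha'] Qa'; [|auto]. apply Rnot_lt_le. intro hl. apply hx. split; [exact Qa'|lra].
  - destruct (classic (Q x)) as [Qx|Qx].
    + exists x. split; [exact Qx|]. split; [left; reflexivity|].
      intros a' [<-|ha'] Qa'; [lra|]. exfalso; eauto.
    + exfalso. destruct H0 as [a [[<-|ha] Qa]]; [auto|eauto].
Qed.

Section TwistedSum.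
Context {K : Type} (T : Topology K) (Tcomp : compact T) (x y : W -> K).
Context (null : forall g e, continuous_real T g -> 0 < e ->
   exists l : list W, forall b, ~ In b l -> Rabs (g (x b) - g (y b)) < e).

Lemma continuous_bounded f : continuous_real T f -> bounded f.
Proof.
  intros fc. destruct (Tcomp (fun U => is_open T U /\ exists M, forall z, U z -> Rabs (f z) <= M))
    as [L [HL Lc]].
  - tauto.
  - intro z. destruct (fc z 1 Rlt_0_1) as [U [Uo [Uz HU]]]. exists U. split; [|exact Uz].
    split; [exact Uo|]. exists (Rabs (f z) + 1). intros t Ut. specialize (HU t Ut).
    revert HU. unfold Rabs. repeat destruct Rcase_abs; lra.
  - assert (H : exists M, forall U z, In U L -> U z -> Rabs (f z) <= M).
    { clear Lc. induction L as [|U L IH]; [exists 0; intros U z []|].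
      destruct IH as [M HM]; [intros V h; apply HL; right; exact h|].
      destruct (HL U (or_introl eq_refl)) as [_ [M' HM']].
      exists (Rmax M M'). intros V z [<-|h] Vz.
      - apply Rle_trans with (1 := HM' z Vz). apply Rmax_r.
      - apply Rle_trans with (1 := HM V z h Vz). apply Rmax_l. }
    destruct H as [M HM]. exists M. intro z. destruct (Lc z) as [U [hU Uz]]. eauto.
Qed.

Lemma continuous_space : function_space (continuous_real T).
Proof.
  split.
  - intros z e He. exists (fun _ => True). split; [apply open_full|]. split; [exact Logic.I|].
    intros. rewrite Rminus_diag, Rabs_R0. exact He.
  - intros f g fc gc z e He.
    destruct (fc z (e / 2)) as [U [Uo [Uz HU]]]; [lra|].
    destruct (gc z (e / 2)) as [V [Vo [Vz HV]]]; [lra|].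
    exists (fun t => U t /\ V t). split; [apply open_inter; assumption|]. split; [auto|].
    intros t [Ut Vt]. specialize (HU t Ut). specialize (HV t Vt).
    revert HU HV. unfold Rabs. repeat destruct Rcase_abs; lra.
  - intros a f fc. apply (continuous_lipschitz T f (fun r => a * r) (Rabs a)); [apply Rabs_pos| |exact fc].
    intros u v. rewrite <- Rabs_mult. right. f_equal. ring.
  - exact continuous_bounded.
  - intros u l uc Hl z e He. destruct (Hl (e / 4)) as [N HN]; [lra|].
    destruct (uc N z (e / 4)) as [U [Uo [Uz HU]]]; [lra|].
    exists U. split; [exact Uo|]. split; [exact Uz|]. intros t Ut. specialize (HU t Ut).
    generalize (HN N t (le_n N)) (HN N z (le_n N)). revert HU.
    unfold Rabs. repeat destruct Rcase_abs; lra.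
Qed.

(* The pullback of the quotient map from bounded sequences to bounded sequences
   modulo [c0] along [f |-> sum_b (f (x b) - f (y b)) 1_(branch b)]; the third
   condition says that the sequence is small off finitely many branches. *)
Definition pullback (w : K + nat -> R) : Prop :=
  continuous_real T (fun z => w (inl z)) /\
  (forall b, Un_cv (fun k => w (inr (node b k))) (w (inl (x b)) - w (inl (y b)))) /\
  (forall e, 0 < e -> exists (l : list W) N, forall n, (N <= n)%nat ->
     (forall b, In b l -> ~ through b n) -> Rabs (w (inr n)) <= e) /\
  bounded w.

Lemma pullback_space : function_space pullback.
Proof.
  assert (CS := continuous_space).
  split.
  - split; [apply (fs_zero _ CS)|]. split; [|split].
    + intros b e He. exists 0%nat. intros. unfold Rdist. rewrite !Rminus_diag, Rabs_R0. exact He.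
    + intros e He. exists nil, 0%nat. intros. rewrite Rabs_R0. lra.
    + exists 0. intros. rewrite Rabs_R0. lra.
  - intros f g [f1 [f2 [f3 [Mf f4]]]] [g1 [g2 [g3 [Mg g4]]]].
    split; [apply (fs_add _ CS); assumption|]. split; [|split].
    + intro b. replace (f (inl (x b)) + g (inl (x b)) - (f (inl (y b)) + g (inl (y b)))) with
        ((f (inl (x b)) - f (inl (y b))) + (g (inl (x b)) - g (inl (y b)))) by ring.
      apply CV_plus; auto.
    + intros e He. destruct (f3 (e / 2)) as [l [N H]]; [lra|].
      destruct (g3 (e / 2)) as [l' [N' H']]; [lra|].
      exists (l ++ l'), (max N N'). intros n hn hl.
      apply Rle_trans with (1 := Rabs_triang _ _). replace e with (e / 2 + e / 2) by field.
      apply Rplus_le_compat; [apply H|apply H']; try lia; intros b hb; apply hl, in_or_app; auto.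
    + exists (Mf + Mg). intro z. apply Rle_trans with (1 := Rabs_triang _ _). apply Rplus_le_compat; auto.
  - intros a f [f1 [f2 [f3 [Mf f4]]]]. split; [apply (fs_scal _ CS a _ f1)|]. split; [|split].
    + intro b. replace (a * f (inl (x b)) - a * f (inl (y b))) with
        (a * (f (inl (x b)) - f (inl (y b)))) by ring.
      apply CV_mult; [|apply f2]. intros e He. exists 0%nat. intros.
      unfold Rdist. rewrite Rminus_diag, Rabs_R0. exact He.
    + intros e He. assert (Ha := Rabs_pos a). destruct (f3 (e / (Rabs a + 1))) as [l [N H]].
      { apply Rdiv_lt_0_compat; lra. }
      exists l, N. intros n hn hl. specialize (H n hn hl). rewrite Rabs_mult.
      apply Rle_trans with ((Rabs a + 1) * (e / (Rabs a + 1))).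
      * apply Rmult_le_compat; try apply Rabs_pos; lra.
      * right. field. lra.
    + exists (Rabs a * Mf). intro z. rewrite Rabs_mult. apply Rmult_le_compat_l; [apply Rabs_pos|auto].
  - intros f [_ [_ [_ h]]]. exact h.
  - intros u l Hu Hl. split; [|split; [|split]].
    + apply (fs_limit _ CS (fun n z => u n (inl z))); [intro n; apply (Hu n)|].
      intros e He. destruct (Hl e He) as [N HN]. exists N. intros n z hn. apply HN. exact hn.
    + intros b e He. destruct (Hl (e / 4)) as [N HN]; [lra|].
      destruct (proj1 (proj2 (Hu N)) b (e / 4)) as [k0 Hk]; [lra|]. exists k0. intros k hk.
      specialize (Hk k hk). unfold Rdist in *.
      generalize (HN N (inl (x b)) (le_n N)) (HN N (inl (y b)) (le_n N)) (HN N (inr (node b k)) (le_n N)).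
      intros q1 q2 q3. apply Rabs_def2 in Hk.
      assert (Q : forall r s, Rabs r <= s -> - s <= r <= s).
      { intros r s. unfold Rabs. destruct Rcase_abs; lra. }
      apply Q in q1, q2, q3. apply Rabs_def1; lra.
    + intros e He. destruct (Hl (e / 2)) as [N HN]; [lra|].
      destruct (proj1 (proj2 (proj2 (Hu N))) (e / 2)) as [s [M H]]; [lra|].
      exists s, M. intros n hn hs. specialize (H n hn hs).
      generalize (HN N (inr n) (le_n N)). revert H. unfold Rabs. repeat destruct Rcase_abs; lra.
    + destruct (Hl 1 Rlt_0_1) as [N HN]. destruct (proj2 (proj2 (proj2 (Hu N)))) as [M HM].
      exists (M + 1). intro z. generalize (HN N z (le_n N)) (HM z).
      unfold Rabs. repeat destruct Rcase_abs; lra.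
Qed.

Lemma pullback_c0 (u : nat -> R) : Un_cv u 0 ->
  pullback (fun t => match t with inl _ => 0 | inr n => u n end).
Proof.
  intros Hu. split; [apply (fs_zero _ continuous_space)|]. split; [|split].
  - intros b e He. destruct (Hu e He) as [N HN]. exists N. intros k hk.
    rewrite Rminus_diag. apply HN. generalize (node_ge b k). lia.
  - intros e He. destruct (Hu e He) as [N HN]. exists nil, N. intros n hn _.
    specialize (HN n hn). unfold Rdist in HN. rewrite Rminus_0_r in HN. lra.
  - destruct (maj_by_pos u (exist _ 0 Hu)) as [M [HM H]]. exists M. intros [z|n]; [|apply H].
    rewrite Rabs_R0. lra.
Qed.

(** The values tend to 0 along each of finitely many branches and are uniformly small off them. *)
Lemma pullback_kernel w : pullback w -> (forall z, w (inl z) = 0) -> Un_cv (fun n => w (inr n)) 0.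
Proof.
  intros [_ [h2 [h3 _]]] h0 e He.
  destruct (h3 (e / 2)) as [l [N HN]]; [lra|].
  assert (H : exists M, forall b n, In b l -> through b n -> (M <= n)%nat -> Rabs (w (inr n)) < e).
  { clear HN. induction l as [|b l [M IH]]; [exists 0%nat; intros b n []|].
    destruct (h2 b e He) as [k0 Hk]. rewrite !h0, Rminus_diag in Hk. unfold Rdist in Hk.
    (* A node of the branch numbered beyond [M'] has depth at least [k0]. *)
    assert (B : exists M', forall k, (k < k0)%nat -> (node b k < M')%nat).
    { clear. induction k0 as [|k0 [M' H]]; [exists 0%nat; lia|].
      exists (max M' (S (node b k0))). intros k hk.
      destruct (Nat.eq_dec k k0) as [->|hne]; [lia|]. specialize (H k ltac:(lia)). lia. }
    destruct B as [M' HM']. exists (max M M'). intros b' n [<-|hl] ht hn.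
    - destruct ht as [k ->]. rewrite <- (Rminus_0_r (w _)). apply Hk.
      destruct (Nat.le_gt_cases k0 k) as [c|c]; [exact c|]. specialize (HM' k c). lia.
    - apply (IH b' n hl ht). lia. }
  destruct H as [M HM]. exists (max N M). intros n hn. unfold Rdist. rewrite Rminus_0_r.
  destruct (classic (forall b, In b l -> ~ through b n)) as [c|c].
  - specialize (HN n ltac:(lia) c). lra.
  - apply not_all_ex_not in c as [b hb]. apply imply_to_and in hb as [hb hc].
    apply (HM b n hb); [apply NNPP; exact hc|lia].
Qed.

(* At a node the value of largest modulus among the branches through it is used. *)
Lemma pullback_onto f : continuous_real T f ->
  exists w, pullback w /\ forall z, w (inl z) = f z.
Proof.
  intros fc. set (mu := fun b => f (x b) - f (y b)).
  assert (nul : forall e, 0 < e -> exists l : list W, forall b, ~ In b l -> Rabs (mu b) < e).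
  { intros e He. exact (null f e fc He). }
  assert (Hu : forall n, exists r,
     (exists b, through b n /\ r = mu b /\ forall b', through b' n -> Rabs (mu b') <= Rabs r) \/
     (r = 0 /\ forall b', through b' n -> mu b' = 0)).
  { intro n. destruct (classic (exists b, through b n /\ mu b <> 0)) as [[b0 [h1 h2]]|h].
    - destruct (nul (Rabs (mu b0))) as [l Hl]; [apply Rabs_pos_lt; exact h2|].
      assert (Q : forall b, ~ Rabs (mu b) < Rabs (mu b0) -> In b l).
      { intros b hb. apply NNPP. intro c. apply hb. apply Hl. exact c. }
      destruct (list_argmax (fun b => Rabs (mu b)) (fun b => through b n) l) as [b [t1 [t2 t3]]].
      { exists b0. split; [apply Q; lra|exact h1]. }
      exists (mu b). left. exists b. split; [exact t1|]. split; [reflexivity|].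
      intros b' hb'. destruct (classic (In b' l)) as [c|c]; [apply t3; assumption|].
      apply Hl in c. assert (Rabs (mu b0) <= Rabs (mu b)); [|lra]. apply t3; [apply Q; lra|exact h1].
    - exists 0. right. split; [reflexivity|]. intros b' hb'. apply NNPP. intro c. apply h; eauto. }
  destruct (choice _ Hu) as [u HU].
  destruct (continuous_bounded f fc) as [M HM].
  exists (fun t => match t with inl z => f z | inr n => u n end). split; [|reflexivity].
  split; [exact fc|]. split; [|split].
  - intros b e He. fold (mu b).
    (* With this threshold, a branch at which [mu] is at least as large as at a nonzero [mu b] must
       be in the list [l], hence is eventually separated from [b]. *)
    set (d := if Req_dec_T (mu b) 0 then e else Rmin e (Rabs (mu b))).
    assert (Hd : 0 < d).
    { unfold d. destruct Req_dec_T as [h|h]; [exact He|]. apply Rmin_glb_lt; [exact He|].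
      apply Rabs_pos_lt. exact h. }
    destruct (nul d Hd) as [l Hl]. destruct (through_separated b l) as [N HN].
    exists N. intros k hk. assert (tb : through b (node b k)) by (exists k; reflexivity).
    destruct (HU (node b k)) as [[b' [t1 [t2 t3]]]|[t1 t2]].
    + rewrite t2 in *. destruct (classic (In b' l)) as [c|c].
      * rewrite (HN k b' hk c t1). unfold Rdist. rewrite Rminus_diag, Rabs_R0. exact He.
      * apply Hl in c. specialize (t3 b tb). unfold d in c. destruct Req_dec_T as [h|h].
        -- unfold Rdist. rewrite h, Rminus_0_r. exact c.
        -- generalize (Rmin_r e (Rabs (mu b))). lra.
    + rewrite t1, (t2 b tb). unfold Rdist. rewrite Rminus_diag, Rabs_R0. exact He.
  - intros e He. destruct (nul e He) as [l Hl]. exists l, 0%nat. intros n _ hn.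
    destruct (HU n) as [[b [t1 [-> _]]]|[-> _]]; [|rewrite Rabs_R0; lra].
    left. apply Hl. intro c. exact (hn b c t1).
  - exists (M + M). intros [z|n].
    + generalize (HM z) (Rabs_pos (f z)). lra.
    + destruct (HU n) as [[b [_ [-> _]]]|[-> _]].
      * unfold mu. generalize (HM (x b)) (HM (y b)). unfold Rabs. repeat destruct Rcase_abs; lra.
      * rewrite Rabs_R0. generalize (HM (x (fun _ => 0%Z))) (Rabs_pos (f (x (fun _ => 0%Z)))). lra.
Qed.

End TwistedSum.

(** * Nontriviality *)

Fixpoint partial_sum {A : Type} (F : nat -> A -> R) (k : nat) (a : A) : R :=
  match k with O => 0 | S k => partial_sum F k a + F k a end.

Lemma fs_partial_sum {A : Type} (P : (A -> R) -> Prop) F k :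
  function_space P -> (forall j, (j < k)%nat -> P (F j)) -> P (partial_sum F k).
Proof.
  intros HP. induction k as [|k IH]; intros H; [apply (fs_zero P HP)|].
  apply (fs_add P HP); [apply IH; intros; apply H|apply H]; lia.
Qed.

Lemma partial_sum_disjoint {A : Type} (F : nat -> A -> R) k a :
  (forall j, (j < k)%nat -> 0 <= F j a <= 1) ->
  (forall i j, (i < k)%nat -> (j < k)%nat -> F i a <> 0 -> F j a <> 0 -> i = j) ->
  0 <= partial_sum F k a <= 1.
Proof.
  intros H D.
  assert (Q : 0 <= partial_sum F k a <= 1 /\
              (partial_sum F k a <> 0 -> exists j, (j < k)%nat /\ F j a <> 0)); [|tauto].
  induction k as [|k IH]; [simpl; lra|].
  destruct IH as [h1 h2]; [intros; apply H; lia|intros; apply D; auto; lia|].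
  simpl. destruct (Req_dec (F k a) 0) as [E|E].
  - rewrite E, Rplus_0_r. split; [exact h1|]. intros h. destruct (h2 h) as [j [hj Hj]].
    exists j. split; [lia|exact Hj].
  - destruct (Req_dec (partial_sum F k a) 0) as [E'|E'].
    + rewrite E', Rplus_0_l. split; [apply H; lia|]. intros _. exists k. split; [lia|exact E].
    + destruct (h2 E') as [j [hj Hj]]. exfalso.
      assert (j = k) by (apply D; auto; lia). lia.
Qed.

Section Nontrivial.
Context {K : Type} (T : Topology K) (Tcomp : compact T).
Context (idx : W -> nat) (U : nat -> K -> Prop) (x y : W -> K) (f : W -> K -> R).
Context (idx_thick : forall (m : W -> nat) (k : nat), exists (b : nat -> W) (L : nat),
  forall j, (j < k)%nat -> idx (b j) = j /\ (m (b j) <= L)%nat /\ agree L (b 0%nat) (b j)).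
Context (U_disjoint : forall m n z, U m z -> U n z -> m = n).
Context (f_bump : forall b, continuous_real T (f b) /\ (forall z, 0 <= f b z <= 1) /\
       f b (x b) = 1 /\ f b (y b) = 0 /\ forall z, ~ U (idx b) z -> f b z = 0).
Context (null : forall g e, continuous_real T g -> 0 < e ->
       exists l : list W, forall b, ~ In b l -> Rabs (g (x b) - g (y b)) < e).

Let P := pullback T x y.

(* A complement [N] of [c0] would lift bounded functions boundedly.  The lift of
   [f b] is eventually at least [1/2] along the branch [b]; thickness yields many
   branches of distinct indices sharing a node past their thresholds, and there
   the lift of the sum of the disjoint bumps is large. *)
Lemma no_complement (N : (K + nat -> R) -> Prop) :
  function_space N -> (forall w, N w -> P w) ->
  (forall w, N w -> (forall z, w (inl z) = 0) -> forall t, w t = 0) ->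
  (forall g, continuous_real T g -> exists w, N w /\ forall z, w (inl z) = g z) -> False.
Proof.
  intros HN NP N0 Nonto.
  destruct (bounded_lift inl N (continuous_real T) HN (continuous_space T Tcomp)) as [C HC].
  { intros w Nw. apply (NP w Nw). }
  { exact Nonto. }
  destruct (choice _ (fun b => Nonto (f b) (proj1 (f_bump b)))) as [v Hv].
  assert (Hm : forall b, exists m, forall k, (m <= k)%nat -> 1 / 2 <= v b (inr (node b k))).
  { intro b. destruct (Hv b) as [Nv Ev]. destruct (NP _ Nv) as [_ [h _]].
    destruct (h b (1 / 2)) as [m Hm]; [lra|]. exists m. intros k hk. specialize (Hm k hk).
    rewrite !Ev in Hm. destruct (f_bump b) as [_ [_ [h1 [h2 _]]]]. rewrite h1, h2 in Hm.
    unfold Rdist in Hm. apply Rabs_def2 in Hm. lra. }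
  destruct (choice _ Hm) as [m Hm2].
  (* Each of [k] branches will contribute at least 1/2 at the common node, against the bound [C]. *)
  destruct (INR_unbounded (2 * C)) as [k hk].
  destruct (idx_thick m k) as [b [L Hb]].
  destruct (HC (partial_sum (fun j => f (b j)) k)) as [w [Nw [Ew Bw]]].
  { apply fs_partial_sum; [apply continuous_space; exact Tcomp|]. intros j _. apply f_bump. }
  { intro z. assert (Q : 0 <= partial_sum (fun j => f (b j)) k z <= 1).
    { apply partial_sum_disjoint.
      - intros j _. apply f_bump.
      - intros i j hi hj Fi Fj. destruct (Hb i hi) as [<- _], (Hb j hj) as [<- _].
        apply (U_disjoint _ _ z); apply NNPP; intro h; [apply Fi|apply Fj]; apply f_bump; exact h. }
    rewrite Rabs_right; lra. }
  (* Lifts in [N] are unique, so the bounded lift of the sum is the sum of the individual lifts. *)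
  assert (E : forall t, w t = partial_sum (fun j => v (b j)) k t).
  { intro t. apply Rminus_diag_uniq. revert t. apply N0.
    - apply (fs_sub N w _ HN Nw). apply fs_partial_sum; [exact HN|]. intros j _. apply Hv.
    - intro z. rewrite Ew. apply Rminus_diag_eq. clear - Hv. induction k as [|k IH]; [reflexivity|].
      simpl. rewrite IH, (proj2 (Hv (b k))). reflexivity. }
  assert (Q : INR k * (1 / 2) <= w (inr (node (b 0%nat) L))).
  { rewrite E. clear - Hb Hm2. revert Hb.
    assert (G : forall k', (k' <= k)%nat -> (forall j, (j < k)%nat ->
       idx (b j) = j /\ (m (b j) <= L)%nat /\ agree L (b 0%nat) (b j)) ->
       INR k' * (1 / 2) <= partial_sum (fun j => v (b j)) k' (inr (node (b 0%nat) L))).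
    { induction k' as [|k' IH]; intros hk Hb; [simpl; lra|].
      rewrite S_INR. cbn [partial_sum]. specialize (IH ltac:(lia) Hb).
      destruct (Hb k' ltac:(lia)) as [_ [h1 h2]].
      rewrite (node_agree _ _ _ h2) in *. specialize (Hm2 (b k') L h1). lra. }
    intros Hb. apply G; auto. }
  specialize (Bw (inr (node (b 0%nat) L))). generalize (Rle_abs (w (inr (node (b 0%nat) L)))). lra.
Qed.

Let Z := function_banach P (pullback_space T Tcomp x y).

Definition c0_inclusion (u : c0) : Z :=
  exist P _ (pullback_c0 T Tcomp x y (proj1_sig u) (proj2_sig u)).

Definition quotient (z : Z) : CK T :=
  exist _ (fun t => proj1_sig z (inl t)) (proj1 (proj2_sig z)).

Lemma pullback_ext (z w : Z) : (forall t, proj1_sig z t = proj1_sig w t) -> z = w.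
Proof. apply fs_ext. Qed.

Lemma nontrivial_pullback : nontrivial_twisted_sum_exists T.
Proof.
  exists Z, c0_inclusion, quotient.
  assert (bdd : forall z : Z, bounded (proj1_sig z)).
  { intro z. exact (fs_bounded _ (pullback_space T Tcomp x y) _ (proj2_sig z)). }
  assert (ker : forall z, (exists u, c0_inclusion u = z) <-> forall t, proj1_sig (quotient z) t = 0).
  { intro z. split.
    - intros [u <-] t. reflexivity.
    - intros h. exists (exist (fun u => Un_cv u 0) _ (pullback_kernel T x y _ (proj2_sig z) h)).
      apply pullback_ext. intros [t|n]; simpl; [symmetry; apply h|reflexivity]. }
  split; [split; [|split]|].
  - split; [|split].
    + intros u v s Es. apply pullback_ext. intros [t|n]; simpl; [ring|apply Es].
    + intros a u s Es. apply pullback_ext. intros [t|n]; simpl; [ring|apply Es].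
    + exists 1. intros u r Hr. rewrite Rmult_1_l.
      assert (0 <= r) by (apply Rle_trans with (2 := Hr 0%nat); apply Rabs_pos).
      apply sup_norm_le; [apply (bdd (c0_inclusion u))|assumption|].
      intros [t|n]; simpl; [rewrite Rabs_R0; assumption|apply Hr].
  - split; [reflexivity|]. split; [reflexivity|].
    exists 1. intros z t. rewrite Rmult_1_l. apply (sup_norm_ge (proj1_sig z) (inl t)). apply bdd.
  - split; [|split; [|exact ker]].
    + intros [u Hu] [v Hv] E. apply eq_sig_hprop; [intros; apply proof_irrelevance|].
      apply functional_extensionality. intro n.
      exact (f_equal (fun z : Z => proj1_sig z (inr n)) E).
    + intros [g gc]. destruct (pullback_onto T Tcomp x y null g gc) as [w [Pw Ew]].
      exists (exist P w Pw). exact Ew.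
  - intros [N [[Nz [Na [Ns Nl]]] [Ni Nd]]].
    apply (no_complement (fun w => exists h : P w, N (exist P w h))).
    + split.
      * exists (fs_zero P (pullback_space T Tcomp x y)). exact Nz.
      * intros g h [Pg Ng] [Ph Nh]. exists (fs_add P (pullback_space T Tcomp x y) _ _ Pg Ph).
        exact (Na _ _ Ng Nh).
      * intros a g [Pg Ng]. exists (fs_scal P (pullback_space T Tcomp x y) a _ Pg). exact (Ns a _ Ng).
      * intros g [Pg _]. apply (bdd (exist P g Pg)).
      * intros u l Hu Hl.
        assert (Pl : P l).
        { apply (fs_limit P (pullback_space T Tcomp x y) u l); [|exact Hl]. intro n. destruct (Hu n). assumption. }
        destruct (choice (fun n (z : Z) => proj1_sig z = u n /\ N z)) as [s Hs].
        { intro n. destruct (Hu n) as [h Nh]. exists (exist P (u n) h). auto. }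
        exists Pl. apply (Nl s); [intro n; apply Hs|].
        intros e He. destruct (Hl (e / 2)) as [M HM]; [lra|]. exists M. intros n hn.
        apply Rle_lt_trans with (e / 2); [|lra].
        apply sup_norm_le; [apply (bdd (badd (s n) (bopp (exist P l Pl : Z))))|lra|].
        intro t. simpl. rewrite (proj1 (Hs n)).
        replace (u n t + -1 * l t) with (u n t - l t) by ring. apply HM. exact hn.
    + intros w [h _]. exact h.
    + intros w [h Nh] h0 t.
      assert (E : exist P w h = bzero :> Z).
      { apply Ni; [|exact Nh]. apply ker. exact h0. }
      exact (f_equal (fun z : Z => proj1_sig z t) E).
    + intros g gc. destruct (pullback_onto T Tcomp x y null g gc) as [w [Pw Ew]].
      (* Removing the [c0] component does not change the values on [K]. *)
      destruct (Nd (exist P w Pw : Z)) as [a [b [Ma [Nb Eab]]]].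
      exists (proj1_sig b). split.
      * exists (proj2_sig b). destruct b as [b Pb]. exact Nb.
      * intro z. rewrite <- Ew. assert (Q := f_equal (fun z' : Z => proj1_sig z' (inl z)) Eab).
        simpl in Q.
        assert (Ma0 := proj1 (ker a) Ma z). simpl in Ma0. rewrite Q, Ma0. ring.
Qed.

End Nontrivial.

(** * Weight and metrizability *)

(** Partial sums of the Cantor set expansion with digits 0 and 2; base 3 avoids double
    representations. *)
Fixpoint ternary (b : nat -> bool) (n : nat) : R :=
  match n with O => 0 | S n => ternary b n + (if b n then 2 * (/ 3) ^ S n else 0) end.

Lemma ternary_tail b k m :
  ternary b k <= ternary b (m + k)%nat <= ternary b k + (/ 3) ^ k - (/ 3) ^ (m + k)%nat.
Proof.
  induction m as [|m IH]; [simpl; lra|].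
  change (S m + k)%nat with (S (m + k)).
  assert (0 < (/ 3) ^ (m + k)%nat) by (apply pow_lt; lra).
  simpl. destruct (b (m + k)%nat); lra.
Qed.

Lemma ternary_lub b : exists r, is_lub (fun s => exists n, s = ternary b n) r.
Proof.
  destruct (completeness (fun s => exists n, s = ternary b n)) as [r Hr]; [| |eauto].
  - exists 1. intros s [n ->]. generalize (proj2 (ternary_tail b 0 n)).
    rewrite Nat.add_0_r. assert (0 < (/ 3) ^ n) by (apply pow_lt; lra). simpl. lra.
  - exists 0, 0%nat. reflexivity.
Qed.

Lemma ternary_lt b b' k r r' :
  is_lub (fun s => exists n, s = ternary b n) r -> is_lub (fun s => exists n, s = ternary b' n) r' ->
  (forall i, (i < k)%nat -> b i = b' i) -> b k = true -> b' k = false -> r' < r.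
Proof.
  intros [h _] [_ h'] E Bt Bf.
  assert (Q : ternary b k = ternary b' k).
  { clear - E. induction k as [|k IH]; [reflexivity|]. simpl. rewrite IH, E by (intros; auto). reflexivity. }
  assert (P3 : 0 < (/ 3) ^ S k) by (apply pow_lt; lra).
  apply Rle_lt_trans with (ternary b k + (/ 3) ^ S k).
  - apply h'. intros s [n ->].
    assert (T : ternary b' (S k) = ternary b k) by (simpl; rewrite Bf, Q; ring).
    destruct (Nat.le_gt_cases (S k) n) as [c|c].
    + generalize (proj2 (ternary_tail b' (S k) (n - S k))).
      replace (n - S k + S k)%nat with n by lia. rewrite T.
      assert (0 < (/ 3) ^ n) by (apply pow_lt; lra). lra.
    + generalize (proj1 (ternary_tail b' n (S k - n))).
      replace (S k - n + n)%nat with (S k) by lia. rewrite T. lra.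
  - apply Rlt_le_trans with (ternary b (S k)); [cbn [ternary]; rewrite Bt; lra|].
    apply h. exists (S k). reflexivity.
Qed.

Lemma big_R : big (fun _ : R => True).
Proof.
  (* The characteristic sequence of the graph of [w]. *)
  set (bits := fun (w : W) n => let p := Cantor.of_nat n in
    if Z.eq_dec (w (fst p)) (Z.of_nat (fst (Cantor.of_nat (snd p))) - Z.of_nat (snd (Cantor.of_nat (snd p))))
    then true else false).
  destruct (choice _ (fun w => ternary_lub (bits w))) as [r Hr].
  exists r. split; [auto|]. intros w w' _ _ E.
  assert (B : forall n, bits w n = bits w' n).
  { intro n. induction n as [n IH] using (well_founded_induction Wf_nat.lt_wf).
    destruct (bits w n) eqn:E1, (bits w' n) eqn:E2; auto; exfalso.
    - generalize (ternary_lt _ _ n _ _ (Hr w) (Hr w') IH E1 E2). lra.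
    - generalize (ternary_lt _ _ n _ _ (Hr w') (Hr w) (fun i h => eq_sym (IH i h)) E2 E1). lra. }
  apply functional_extensionality. intro k.
  specialize (B (Cantor.to_nat (k, Cantor.to_nat (Z.to_nat (w k), Z.to_nat (- w k))))).
  unfold bits in B. rewrite Cantor.cancel_of_to in B. cbn [fst snd] in B.
  rewrite Cantor.cancel_of_to in B. cbn [fst snd] in B.
  replace (Z.of_nat (Z.to_nat (w k)) - Z.of_nat (Z.to_nat (- w k)))%Z with (w k) in B by lia.
  destruct (Z.eq_dec (w k) (w k)); [|contradiction].
  destruct (Z.eq_dec (w' k) (w k)); congruence.
Qed.

Section Weight.
Context {K I : Type} (T : Topology K) (phi : K -> I -> R).
Context (Tcomp : compact T) (phi_cont : continuous_into_product T phi).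
Context (phi_inj : forall x y, phi x = phi y -> x = y).

Lemma open_in_box s : is_open T (in_box phi s).
Proof.
  induction s as [|[i [n k]] s IH].
  - replace (in_box phi nil) with (fun _ : K => True); [apply open_full|].
    apply pred_ext. intro x. split; [intros _ i n k []|auto].
  - replace (in_box phi ((i, (n, k)) :: s))
      with (fun x => Rabs (phi x i - rational n) < / (INR k + 1) /\ in_box phi s x).
    + apply open_inter; [apply open_coord_near; exact phi_cont|exact IH].
    + apply pred_ext. intro x. split.
      * intros [h1 h2] i' n' k' [E|h]; [injection E as <- <- <-; exact h1|auto].
      * intros h. split; [apply h; left; reflexivity|]. intros i' n' k' h'. apply h. right. exact h'.
Qed.

(** Rational boxes over the coordinates that occur form a base, which is small if these coordinates
    are. *)
Lemma weight_big_coords : weight_ge_continuum T -> big (coords phi (fun _ => True)).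
Proof.
  intros HW. set (J := coords phi (fun _ => True)).
  destruct (HW (fun V => exists s, over J s /\ V = in_box phi s)) as [f [fB finj]].
  - split.
    + intros V [s [_ ->]]. apply open_in_box.
    + intros V x Vo Vx.
      destruct (box_relative T phi Tcomp phi_cont phi_inj (fun _ => True) V x Vo Vx Logic.I)
        as [s [h1 [h2 h3]]].
      exists (in_box phi s). split; [exists s; auto|]. split; [exact h2|]. intros z hz. apply h3; auto.
  - apply NNPP. intros hs. apply (small_codes J hs).
    destruct (choice _ fB) as [s Hs]. apply (big_embeds (fun _ : R => True)); [|exact big_R].
    exists s. split; [intros r _; apply Hs|]. intros r r' _ _ E. apply finj. intro x.
    rewrite (proj2 (Hs r)), (proj2 (Hs r')), E. tauto.
Qed.

(** The truncation of coordinate [i] at [1/(g i + 1)] leaves finitely many coordinates to control at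
    each scale. *)
Lemma countable_coords_metrizable : countable_set (coords phi (fun _ => True)) -> metrizable T.
Proof.
  intros [g Hg]. set (J := coords phi (fun _ => True)) in *.
  assert (J0 : forall i x, ~ J i -> phi x i = 0).
  { intros i x h. apply NNPP. intro h'. apply h. exists x. auto. }
  set (h := fun x y i => Rmin (Rabs (phi x i - phi y i)) (/ (INR (g i) + 1))).
  assert (h0 : forall x y i, 0 <= h x y i).
  { intros x y i. apply Rmin_glb; [apply Rabs_pos|left; apply inv_succ_pos]. }
  assert (hb : forall x y, bounded (h x y)).
  { intros x y. exists 1. intro i. rewrite Rabs_right by (apply Rle_ge, h0).
    apply Rle_trans with (1 := Rmin_r _ _). rewrite <- Rinv_1. apply Rinv_le_contravar; [lra|].
    generalize (pos_INR (g i)). lra. }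
  assert (hd : forall x y i, h x y i <= sup_norm (h x y)).
  { intros x y i. rewrite <- (Rabs_right (h x y i)) by (apply Rle_ge, h0). apply sup_norm_ge, hb. }
  assert (dh : forall x y r, 0 <= r -> (forall i, h x y i <= r) -> sup_norm (h x y) <= r).
  { intros x y r hr H. apply sup_norm_le; [apply hb|exact hr|]. intro i.
    rewrite Rabs_right by (apply Rle_ge, h0). apply H. }
  exists (fun x y => sup_norm (h x y)). split; [|split; [|split]].
  - intros x y. split.
    + intros E. apply phi_inj. apply functional_extensionality. intro i.
      specialize (hd x y i). rewrite E in hd. specialize (h0 x y i).
      apply Rminus_diag_uniq. apply NNPP. intro hne. apply Rabs_pos_lt in hne.
      assert (0 < h x y i); [|lra]. apply Rmin_glb_lt; [exact hne|apply inv_succ_pos].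
    + intros ->. apply Rle_antisym; [|apply sup_norm_pos, hb]. apply dh; [lra|]. intro i. unfold h.
      rewrite Rminus_diag, Rabs_R0. apply Rmin_l.
  - intros x y. f_equal. apply functional_extensionality. intro i. unfold h.
    rewrite Rabs_minus_sym. reflexivity.
  - intros x y z. apply dh; [apply Rplus_le_le_0_compat; apply sup_norm_pos, hb|]. intro i.
    apply Rle_trans with (h x y i + h y z i); [|apply Rplus_le_compat; apply hd].
    assert (Q := Rabs_triang (phi x i - phi y i) (phi y i - phi z i)).
    replace (phi x i - phi y i + (phi y i - phi z i)) with (phi x i - phi z i) in Q by ring.
    generalize (Rabs_pos (phi x i - phi y i)) (Rabs_pos (phi y i - phi z i)) (inv_succ_pos (g i)).
    unfold h, Rmin. repeat destruct Rle_dec; lra.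
  - intro U. split.
    + intros Uo x Ux. destruct (box_nbhd T phi Tcomp phi_cont phi_inj U x Uo Ux) as [l [e [He Hl]]].
      assert (H : exists d, 0 < d /\ d <= e /\ forall i, In i l -> d <= / (INR (g i) + 1)).
      { clear Hl. induction l as [|i l [d [d0 [de dl]]]].
        - exists e. split; [exact He|]. split; [lra|]. intros i [].
        - exists (Rmin d (/ (INR (g i) + 1))). split; [apply Rmin_glb_lt; [exact d0|apply inv_succ_pos]|].
          split; [apply Rle_trans with (1 := Rmin_l _ _); exact de|].
          intros j [<-|hj]; [apply Rmin_r|]. apply Rle_trans with (1 := Rmin_l _ _). auto. }
      destruct H as [d [d0 [de dl]]]. exists d. split; [exact d0|]. intros y hy.
      apply Hl. intros i hi. rewrite Rabs_minus_sym. specialize (hd x y i). specialize (dl i hi).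
      assert (Q : h x y i < d) by lra. revert Q. unfold h, Rmin. destruct Rle_dec; lra.
    + intros HU. apply is_open_local. intros x Ux. destruct (HU x Ux) as [e [He Hb]].
      destruct (inv_succ_lt (e / 2)) as [N HN]; [lra|].
      set (V := fun n y => forall i, J i -> (g i < n)%nat -> Rabs (phi y i - phi x i) < e / 2).
      exists (V (S N)). split; [|split].
      * generalize (S N). clear - phi_cont Hg. induction n as [|n IH].
        -- replace (V 0%nat) with (fun _ : K => True); [apply open_full|].
           apply pred_ext. intro y. split; [intros _ i _ c; lia|auto].
        -- destruct (classic (exists i, J i /\ g i = n)) as [[i [Ji gi]]|hn].
           ++ replace (V (S n)) with (fun y => Rabs (phi y i - phi x i) < e / 2 /\ V n y).
              ** apply open_inter; [apply open_coord_near; exact phi_cont|exact IH].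
              ** apply pred_ext. intro y. split.
                 --- intros [v1 v2] j Jj gj. destruct (Nat.eq_dec (g j) n) as [q|q].
                     +++ rewrite (Hg j i); auto. congruence.
                     +++ apply v2; [exact Jj|lia].
                 --- intros v. split; [apply v; [exact Ji|lia]|]. intros j Jj gj. apply v; [exact Jj|lia].
           ++ replace (V (S n)) with (V n); [exact IH|]. apply pred_ext. intro y. split.
              ** intros v j Jj gj. apply v; [exact Jj|].
                 assert (g j <> n) by (intro q; apply hn; eauto). lia.
              ** intros v j Jj gj. apply v; [exact Jj|lia].
      * intros i _ _. rewrite Rminus_diag, Rabs_R0. lra.
      * intros y Vy. apply Hb. apply Rle_lt_trans with (e / 2); [|lra]. apply dh; [lra|]. intro i.
        destruct (classic (J i)) as [Ji|Ji].
        -- destruct (Nat.le_gt_cases (g i) N) as [c|c].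
           ++ apply Rle_trans with (1 := Rmin_l _ _). rewrite Rabs_minus_sym. left.
              apply Vy; [exact Ji|lia].
           ++ apply Rle_trans with (1 := Rmin_r _ _). left. apply Rle_lt_trans with (2 := HN).
              apply Rinv_le_contravar; [generalize (pos_INR N); lra|].
              apply lt_INR in c. lra.
        -- apply Rle_trans with (1 := Rmin_l _ _). rewrite !J0, Rminus_diag, Rabs_R0 by exact Ji. lra.
Qed.

(** The coordinates either contain a copy of [W] or embed in the reals; in the second case CH
    applies to their image, which is uncountable. *)
Lemma nonmetrizable_big_coords : CH -> ~ metrizable T -> big (coords phi (fun _ => True)).
Proof.
  intros ch hm. set (J := coords phi (fun _ => True)).
  assert (hc : ~ countable_set J) by (intro c; exact (hm (countable_coords_metrizable c))).
  assert (i0 : exists i, J i).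
  { apply NNPP. intro h. apply hc. exists (fun _ => 0%nat). intros a b Ja. exfalso; eauto. }
  destruct i0 as [i0 _].
  destruct (embeds_total i0 (fun _ => 0%Z : Z) J (fun _ : W => True)) as [[e [_ einj]]|h]; [|exact h].
  destruct big_R as [c [_ cinj]].
  destruct (ch (fun r => exists i, J i /\ c (e i) = r)) as [[g Hg]|[f [fJ finj]]].
  - exfalso. apply hc. exists (fun i => g (c (e i))). intros a b Ja Jb E.
    assert (Q := Hg _ _ (ex_intro _ a (conj Ja eq_refl)) (ex_intro _ b (conj Jb eq_refl)) E).
    apply einj; [exact Ja|exact Jb|]. apply cinj; auto.
  - apply (big_embeds (fun _ : R => True)); [|exact big_R].
    destruct (choice _ fJ) as [k Hk]. exists k. split; [intros r _; apply Hk|].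
    intros r s _ _ E. apply finj. destruct (Hk r) as [_ <-], (Hk s) as [_ <-]. rewrite E. reflexivity.
Qed.

End Weight.

Lemma nontrivial_of_big_coords {K I : Type} (T : Topology K) (phi : K -> I -> R) :
  compact T -> continuous_into_product T phi -> (forall x y, phi x = phi y -> x = y) ->
  (forall x, in_Sigma (phi x)) -> big (coords phi (fun _ => True)) ->
  nontrivial_twisted_sum_exists T.
Proof.
  intros Tcomp phi_cont phi_inj phi_sigma HJ.
  destruct thick_partition as [idx Hidx].
  destruct (bump_system T phi Tcomp phi_cont phi_inj phi_sigma idx HJ)
    as [U [x [y [f [h1 [h2 h3]]]]]].
  exact (nontrivial_pullback T Tcomp idx U x y f Hidx h1 h2 h3).
Qed.

Theorem theorem3p2 :
  (forall (K : Type) (T : Topology K),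
      corson T -> weight_ge_continuum T -> nontrivial_twisted_sum_exists T) /\
  (CH -> forall (K : Type) (T : Topology K),
      corson T -> ~ metrizable T -> nontrivial_twisted_sum_exists T).
Proof.
  split.
  - intros K T [[Tc _] [I [phi [h1 [h2 h3]]]]] HW.
    apply (nontrivial_of_big_coords T phi Tc h1 h2 h3). apply (weight_big_coords T); assumption.
  - intros ch K T [[Tc _] [I [phi [h1 [h2 h3]]]]] hm.
    apply (nontrivial_of_big_coords T phi Tc h1 h2 h3). apply (nonmetrizable_big_coords T); assumption.
Qed.
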